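(* There is a finite simple graph $G$ without isolated vertices on $32$ vertices such that $$\operatorname{adw}(G)=6<\operatorname{normw}(G)=\frac{69}{11}<\operatorname{linw}(G)=\frac{44}{7}<\frac{635}{101}\le\operatorname{entw}(G)\le\frac{183}{29}<\operatorname{subw}(G)=\frac{19}{3},$$ where $\operatorname{adw},\operatorname{normw},\operatorname{linw},\operatorname{entw},\operatorname{subw}$ denote the adaptive, normal, linear, entropic and submodular width, respectively.
   Context: Polymatroids. For a finite set $V$, a polymatroid on $V$ is a function $h:2^V\to\mathbb{R}_{\ge0}$ with $h(\emptyset)=0$, $h(U\cup W)\ge h(U)$, and $h(U)+h(W)\ge h(U\cup W)+h(U\cap W)$ for all $U,W\subseteq V$. Let $\Gamma_V$ be the set of polymatroids on $V$. Subclasses (all closed in $\mathbb{R}^{2^V}$): - $M_V$ (modular): $h(U)=\sum_{v\in U}w_v$ for some weights $w_v\ge0$. - $N_V$ (normal): nonnegative linear combinations of step functions $h^K$, $K\subseteq V$, where $h^K(U)=1$ if $U\cap K\ne\emptyset$ and $0$ otherwise. - $\mathrm{Lin}_V$ (linear): limits of nonnegative scalar multiples of rank functions, where a rank function is $r(U)=\dim\operatorname{span}\bigl(\bigcup_{v\in U}\varphi(v)\bigr)$ for some $d$ and some map $\varphi$ assigning to each $v\in V$ a finite subset of $\mathbb{R}^d$. - $\bar\Gamma^*_V$ (almost entropic): the topological closure of the set of entropic functions, i.e. functions $h(U)=H((Y_v)_{v\in U})$ (Shannon entropy) for jointly distributed discrete random variables $(Y_v)_{v\in V}$ of finite entropy.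 Widths. Let $G=(V,E)$ be a finite simple graph without isolated vertices. A tree decomposition of $G$ is a tree $T$ with bags $B_t\subseteq V$ ($t\in V(T)$) such that every edge of $G$ is contained in some bag and, for every $x\in V$, the set $\{t: x\in B_t\}$ is nonempty and connected in $T$. $\mathrm{TD}(G)$ is the set of tree decompositions of $G$. For $h:2^V\to\mathbb{R}_{\ge0}$ put $$\operatorname{w}_h(G)=\min_{(T,B)\in\mathrm{TD}(G)}\max_{t\in V(T)}h(B_t).$$ $h$ is edge dominated on $G$ if $h(e)\le1$ for every $e\in E$; $ED(G)$ is the set of edge dominated functions. Then $\operatorname{adw}(G)=\sup_{h\in M_V\cap ED(G)}\operatorname{w}_h(G)$, $\operatorname{normw}(G)=\sup_{h\in N_V\cap ED(G)}\operatorname{w}_h(G)$, $\operatorname{linw}(G)=\sup_{h\in\mathrm{Lin}_V\cap ED(G)}\operatorname{w}_h(G)$, $\operatorname{entw}(G)=\sup_{h\in\bar\Gamma^*_V\cap ED(G)}\operatorname{w}_h(G)$, $\operatorname{subw}(G)=\sup_{h\in\Gamma_V\cap ED(G)}\operatorname{w}_h(G)$. *)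

(* Defs.v *)
From HB Require Import structures.
From mathcomp Require Import all_boot all_order all_algebra.
From mathcomp Require Import all_classical all_reals all_analysis.

Set Implicit Arguments.
Unset Strict Implicit.
Unset Printing Implicit Defensive.

Import Order.TTheory GRing.Theory Num.Theory.
Import numFieldTopology.Exports numFieldNormedType.Exports.

Local Open Scope classical_set_scope.
Local Open Scope ring_scope.

Record sgraph := SGraph {
  vertex :> finType;
  edge : rel vertex;
  edge_sym : symmetric edge;
  edge_irr : irreflexive edge }.

Definition no_isolated (G : sgraph) : Prop :=
  forall x : G, exists y : G, edge x y.

(* [ucycle] also accepts the sequences [:: x; y] with x, y adjacent; genuine
   cycles have at least three vertices. *)
Definition is_tree (T : sgraph) : Prop :=
  [/\ (0 < #|T|)%N,
      forall s t : T, connect (@edge T) s t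
    & forall c : seq T, (2 < size c)%N -> ~ ucycle (@edge T) c].

Record treedec (G : sgraph) := TreeDec {
  td_tree : sgraph;
  td_treeP : is_tree td_tree;
  bag : td_tree -> {set G};
  bag_edge : forall x y : G, edge x y ->
    exists t, ([set x; y]%SET \subset bag t);
  bag_vertex : forall x : G, exists t, x \in bag t;
  bag_connected : forall (x : G) (s t : td_tree), x \in bag s -> x \in bag t ->
    connect [rel a b | [&& edge a b, x \in bag a & x \in bag b]] s t }.

Section SetFunctions.
Context {R : realType} {V : finType}.
Implicit Types (h r : {set V} -> R) (U W K : {set V}).

Definition polymatroid : set ({set V} -> R) := [set h |
  [/\ forall U, 0 <= h U,
      h finset.set0 = 0,
      forall U W, h U <= h (U :|: W)%SET
    & forall U W, h (U :|: W)%SET + h (U :&: W)%SET <= h U + h W]].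

Definition modular : set ({set V} -> R) := [set h |
  exists w : V -> R, (forall v, 0 <= w v) /\
    forall U, h U = \sum_(v in U) w v].

Definition step K : {set V} -> R :=
  fun U => if (U :&: K)%SET != finset.set0 then 1 else 0.

Definition normal : set ({set V} -> R) := [set h |
  exists c : {set V} -> R, (forall K, 0 <= c K) /\
    forall U, h U = \sum_(K : {set V}) c K * step K U].

(* The finite subset of R^d attached to v is given by an enumeration of it. *)
Definition rank_function : set ({set V} -> R) := [set r |
  exists (d : nat) (phi : V -> seq 'rV[R]_d), forall U,
    r U = (\dim <<flatten [seq phi v | v <- enum U]>>%VS)%:R].

Definition linear_polymatroid : set ({set V} -> R) := [set h |
  exists u : nat -> {set V} -> R,
    (forall n, exists c r, [/\ 0 <= c, rank_function r
                             & forall U, u n U = c * r U])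
    /\ {ptws, u @ \oo --> h}].

End SetFunctions.

(* Shannon entropy in bits of a map with countable range whose fibres are
   measurable.  As [ln 0 = 0], values of probability zero contribute 0.
   The base of the logarithm does not affect [almost_entropic]: the closure of
   the set of entropic functions is a convex cone. *)
Definition entropy (R : realType) (d : measure_display) (T : measurableType d)
    (P : probability T R) (S : choiceType) (X : T -> S) : \bar R :=
  (\esum_(y in range X)
     (let p := fine (P (X @^-1` [set y])) in - (p * (ln p / ln 2)))%:E)%E.

Section Entropic.
Context {R : realType} {V : finType}.

Definition joint (d : measure_display) (T : measurableType d)
    (P : probability T R) (Y : V -> {dRV P >-> R}) (U : {set V}) :
    T -> {ffun {v | v \in U} -> R} :=
  fun omega => [ffun v => Y (val v) omega].

(* Real labels are no restriction, a discrete variable having a countable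
   range.  Finiteness of all the entropies is part of the equation in \bar R. *)
Definition entropic : set ({set V} -> R) := [set h |
  exists (d : measure_display) (T : measurableType d) (P : probability T R)
         (Y : V -> {dRV P >-> R}),
    forall U : {set V}, entropy P (joint Y U) = (h U)%:E].

Definition almost_entropic : set ({set V} -> R) :=
  closure (entropic : set {ptws {set V} -> R}).

End Entropic.

Section Widths.
Context {R : realType} (G : sgraph).
Implicit Types (h : {set G} -> R) (D : treedec G).

Definition edge_dominated : set ({set G} -> R) := [set h |
  (forall U, 0 <= h U) /\
  forall x y : G, edge x y -> h [set x; y]%SET <= 1].

(* For nonnegative h the default value 0 plays no role, trees being nonempty. *)
Definition max_bag h D : R := \big[Num.max/0]_(t : td_tree D) h (bag t).

(* The infimum is a minimum: see [width_attained]. *)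
Definition width h : R := inf [set x | exists D, x = max_bag h D].

Definition sup_width (C : set ({set G} -> R)) : \bar R :=
  ereal_sup [set (width h)%:E | h in C `&` edge_dominated].

Definition adw : \bar R := sup_width modular.
Definition normw : \bar R := sup_width normal.
Definition linw : \bar R := sup_width linear_polymatroid.
Definition entw : \bar R := sup_width almost_entropic.
Definition subw : \bar R := sup_width polymatroid.

Lemma treedec_inhabited : inhabited (treedec G).
Proof.
pose e : rel unit := fun _ _ => false.
have es : symmetric e by [].
have ei : irreflexive e by [].
pose T := SGraph es ei.
have Tt : is_tree T.
  split; [by rewrite card_unit | by move=> [] []; exact: connect0 |].
  by move=> [|[] [|[] c]].
constructor; apply: (@TreeDec G T Tt (fun=> [set: G]%SET)).
- by move=> x y _; exists tt; apply/fintype.subsetP => z _; rewrite inE.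
- by move=> x; exists tt; rewrite inE.
- by move=> x [] [] _ _; exact: connect0.
Qed.

Lemma width_attained h :
  (exists D, width h = max_bag h D) /\ (forall D, width h <= max_bag h D).
Proof.
pose f (s : option {set G}) := if s is Some U then h U else 0.
have fP D : exists s, max_bag h D = f s.
  rewrite /max_bag; elim/big_ind: _ => [|x y [s ->] [t ->]|t _].
  - by exists None.
  - by rewrite /Num.max; case: ifP => _; [exists t | exists s].
  - by exists (Some (bag t)).
have [D0] := treedec_inhabited; have [s0 s0P] := fP D0.
have Ps0 : `[< exists D, max_bag h D = f s0 >] by apply/asboolP; exists D0.
have [s /asboolP[D Ds] smin] :=
  @arg_minP _ R _ s0 (fun s => `[< exists D, max_bag h D = f s >]) f Ps0.
have lbD D' : max_bag h D <= max_bag h D'.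
  have [s' s'P] := fP D'; rewrite Ds s'P; apply: smin.
  by apply/asboolP; exists D'.
suff E : width h = max_bag h D by split=> [|D']; [exists D | rewrite E].
apply/eqP; rewrite eq_le; apply/andP; split.
- apply: ge_inf; last by exists D.
  by exists (max_bag h D) => _ [D' ->].
- apply: lb_le_inf; first by exists (max_bag h D), D.
  by move=> _ [D' ->].
Qed.

End Widths.

Arguments adw R G : clear implicits.
Arguments normw R G : clear implicits.
Arguments linw R G : clear implicits.
Arguments entw R G : clear implicits.
Arguments subw R G : clear implicits.

(* Main.v *)
Require Import Defs.
From HB Require Import structures.
From mathcomp Require Import all_boot all_order all_algebra.
From mathcomp Require Import all_classical all_reals all_analysis.
From mathcomp Require Import zify ring lra.

(** The graph has a core of five vertices A, B, C, D, E with the edges AB, AC,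
    AD, BC, BD, CE, DE.  Five sets of core vertices are called keys: AE, BE, CD,
    ABC and ABD.  Each key comes with two clique vertices and with three or four
    link vertices; the ten clique vertices are pairwise adjacent, and a link
    vertex is adjacent to its key and to the two clique vertices of its key.

    The keys are the minimal transversals of a family of pairwise touching stars
    in the core.  Together with the edges between clique and link vertices, these
    stars form a bramble, so every tree decomposition has a bag that contains a
    key and, for each of the five keys, its clique part or its link part
    ([key_bag]).  Let h be the sum of a function of the core and of a modular
    function in which each of these ten parts has weight 1.  Then the width of h
    is at least 5 plus the least value of a key ([width_ge]).  Conversely, for
    each key there is a tree decomposition in which one bag is the union of the
    key and the clique and each other bag is covered by six edges ([dec_valid]),
    so that the width of an edge dominated polymatroid is at most 5 plus the
    value of any given key, or 6 ([width_le_key]).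

    Hence each width is 5 + s, where s is the largest possible minimum of the
    five key values, subject to the seven core edges having value at most 1.
    For each class this is a small linear program.  Its bounds come from the
    inequalities that hold in the class: submodularity gives 4/3, the Ingleton
    inequality for linear polymatroids gives 9/7, the Zhang-Yeung inequality for
    entropic functions gives 38/29, the inequalities of step functions give
    14/11, and modularity gives 1.  In the first, second, fourth and fifth case
    there are functions that attain the bound.  For an entropic lower bound,
    linear terms are combined with two independent fair bits at C and D, their
    conjunction at A and their disjunction at B.  This violates the Ingleton
    inequality, and with the estimate 4/5 for the entropy of the conjunction
    (because 3^5 <= 2^8) it yields 130/101.

    The Ingleton inequality holds because the intersection of two subspaces
    carries their mutual information ([dim_ingleton]).  The Zhang-Yeung
    inequality is derived from submodularity on a probability space with a
    conditionally independent copy of one of the variables ([ent_zhang_yeung]).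
    Both are proved for finite objects and pass to limits because they are linear
    ([approx_lform_ge0]); discrete random variables are approximated by merging
    all but finitely many of their values ([entropic_approx]).  In the other
    direction, entropic functions are scaled, up to a small error, by revealing
    the variables with small probability only ([finite_entropic_scale]). *)

Set Implicit Arguments.
Unset Strict Implicit.
Unset Printing Implicit Defensive.

Import Order.TTheory GRing.Theory Num.Theory.
Import numFieldTopology.Exports numFieldNormedType.Exports.

(** * Brambles in trees *)

Section Acyclic.
Variables (T : finType) (e : rel T).
Hypotheses (e_sym : symmetric e) (e_irr : irreflexive e)
  (e_acyclic : forall c : seq T, 2 < size c -> ~ ucycle e c).

(** The first vertex of a longest path inside [S] qualifies: all its neighbours
    lie on the path, and one that is not the second vertex closes a cycle. *)
Lemma acyclic_leaf (S : {set T}) : S != finset.set0 ->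
  exists2 x, x \in S &
    forall y z, y \in S -> z \in S -> e x y -> e x z -> y = z.
Proof.
case/set0Pn=> x0 x0S.
pose P n := [exists s : n.-tuple T,
  [&& uniq s, sorted e s & all (mem S) s]].
have exP : exists n, P n.
  by exists 1; apply/existsP; exists [tuple x0]; rewrite /= x0S.
have ubP n : P n -> n <= #|T|.
  case/existsP=> s /and3P[us _ _].
  by rewrite -(size_tuple s) -(card_uniqP us) max_card.
case: (ex_maxnP exP ubP) => n /existsP[[s /= /eqP sn] /and3P[us ps aS]] nmax.
case: s => [|x q] in sn us ps aS *.
  suff : P 1 by move/nmax; rewrite -sn.
  by apply/existsP; exists [tuple x0]; rewrite /= x0S.
move: aS us ps => /= /andP[xS qS] /andP[xq uq] pq.
have headE y : y \in S -> e x y -> y = head x q.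
  move=> yS exy; have yx : y != x by apply: contraL exy => /eqP->; rewrite e_irr.
  have yq : y \in q.
    apply: contraT => yq; suff /nmax : P n.+1 by rewrite ltnn.
    apply/existsP.
    have sz : size (y :: x :: q) == n.+1 by rewrite -sn.
    exists (Tuple sz) => /=.
    by rewrite inE negb_or yx yq xq uq pq qS xS yS e_sym exy.
  case/splitPr: yq xq uq pq {qS sn} => [[|z q1] q2] //= xq uq.
  case/andP=> exz; rewrite cat_path => /andP[p1 /= /andP[elast _]].
  case: (@e_acyclic (x :: z :: rcons q1 y)); first by rewrite /= size_rcons.
  have u : uniq (x :: z :: rcons q1 y).
    have : uniq ((x :: z :: rcons q1 y) ++ q2) by rewrite /= cat_rcons xq.
    by rewrite cat_uniq => /andP[].
  rewrite /ucycle u andbT /= exz rcons_path last_rcons [e y x]e_sym exy andbT.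
  by rewrite rcons_path p1 elast.
by exists x => // y z yS zS exy exz; rewrite (headE y) // -(headE z).
Qed.

(** Removing leaves one after the other orders the vertices so that each has at
    most one neighbour before it, its parent. *)
Lemma acyclic_parent : exists (rk : T -> nat) (p : T -> T), injective rk /\
  forall s t, e s t -> rk s < rk t -> s = p t.
Proof.
suff [rk [p [rkI pP]]] : exists (rk : T -> nat) (p : T -> T),
    {in [set: T] &, injective rk} /\
    {in [set: T] &, forall s t, e s t -> rk s < rk t -> s = p t}.
  by exists rk, p; split=> [s t|s t]; [apply: rkI | apply: pP]; rewrite inE.
have [n] := ubnP #|[set: T]|; elim: n [set: T] => [//|n IHn] S; rewrite ltnS.
have [->|S0] := eqVneq S finset.set0.
  by move=> _; exists (fun=> 0), id; split=> s t; rewrite inE.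
have [x xS xP] := acyclic_leaf S0.
rewrite (cardsD1 x) xS => /IHn[rk [p [rkI pP]]].
pose M := (\max_t rk t).+1.
have rkM t : rk t < M by rewrite ltnS leq_bigmax.
pose px := if [pick y in S | e x y] is Some y then y else x.
exists (fun t => if t == x then M else rk t), (fun t => if t == x then px else p t).
split=> s t sS tS.
  case: (eqVneq s x) => [->|sx]; case: (eqVneq t x) => [-> //|tx] E.
  - by have := rkM t; rewrite -E ltnn.
  - by have := rkM s; rewrite E ltnn.
  - by apply: rkI => //; rewrite !inE ?sx ?tx.
case: (eqVneq s x) => [->|sx]; case: (eqVneq t x) => [->|tx].
- by rewrite e_irr.
- by move=> _ /ltn_trans/(_ (rkM t)); rewrite ltnn.
- rewrite e_sym => exs _; rewrite /px; case: pickP => [y /andP[yS exy]|/(_ s)].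
    exact: xP.
  by rewrite sS exs.
- by apply: pP; rewrite !inE ?sx ?tx.
Qed.

Definition connected_in (S : pred T) := forall s t, S s -> S t ->
  connect [rel a b | [&& e a b, S a & S b]] s t.

Lemma connected_inU (S1 S2 : pred T) u : S1 u -> S2 u ->
  connected_in S1 -> connected_in S2 -> connected_in (predU S1 S2).
Proof.
move=> u1 u2 c1 c2.
have toU s : predU S1 S2 s -> connect
    [rel a b | [&& e a b, predU S1 S2 a & predU S1 S2 b]] s u /\
    connect [rel a b | [&& e a b, predU S1 S2 a & predU S1 S2 b]] u s.
  have sub1 : subrel [rel a b | [&& e a b, S1 a & S1 b]]
      (connect [rel a b | [&& e a b, predU S1 S2 a & predU S1 S2 b]]).
    by move=> a b /= /and3P[ab a1 b1]; apply: connect1; rewrite /= ab a1 b1.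
  have sub2 : subrel [rel a b | [&& e a b, S2 a & S2 b]]
      (connect [rel a b | [&& e a b, predU S1 S2 a & predU S1 S2 b]]).
    move=> a b /= /and3P[ab a1 b1]; apply: connect1.
    by rewrite /= ab a1 b1 !orbT.
  case/orP=> sS; split.
  - exact: connect_sub sub1 _ _ (c1 _ _ sS u1).
  - exact: connect_sub sub1 _ _ (c1 _ _ u1 sS).
  - exact: connect_sub sub2 _ _ (c2 _ _ sS u2).
  - exact: connect_sub sub2 _ _ (c2 _ _ u2 sS).
by move=> s t /toU[su _] /toU[_ ut]; apply: connect_trans su ut.
Qed.

Section Helly.
Variables (rk : T -> nat) (p : T -> T).
Hypotheses (rkI : injective rk)
  (pP : forall s t, e s t -> rk s < rk t -> s = p t).

Lemma path_descends q x y : path e y q -> e x y -> uniq (x :: y :: q) ->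
  rk x < rk y -> rk x < rk (last y q).
Proof.
elim: q x y => [|z q IHq] x y //= /andP[eyz pq] exy.
case/andP=> xq /andP[yq uq] rxy; apply: (ltn_trans rxy).
apply: IHq => //=; first by rewrite yq.
have [//|rzy|/rkI yz] := ltngtP (rk y) (rk z).
  have zx : z = x by rewrite (pP _ rzy) 1?e_sym // -(pP exy rxy).
  by move: xq; rewrite zx !inE eqxx !orbT.
by move: eyz; rewrite yz e_irr.
Qed.

(** A simple path that once steps down to a child keeps going down, so a path
    to the top of a connected set starts with the parent. *)
Lemma parent_in (S : pred T) m t : connected_in S -> S m -> S t ->
  (forall s, S s -> rk m <= rk s) -> t != m -> S (p t) /\ rk (p t) < rk t.
Proof.
move=> cS mS tS mmin tm; have /connectP[q pq lq] := cS _ _ tS mS.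
case/shortenP: pq lq => -[|y q'] /=; first by move=> _ _ _ tm'; rewrite tm' eqxx in tm.
move=> {q} /[swap] uq /andP[/and3P[ety _ yS] pq] _ lq; move: q' => q in pq uq lq *.
have pq' : path e y q by apply: sub_path pq => a b /= /and3P[].
have [rty|ryt|/rkI ty] := ltngtP (rk t) (rk y).
- by have := path_descends pq' ety uq rty; rewrite -lq ltnNge mmin.
- by rewrite -(pP _ ryt) // e_sym.
- by move: ety; rewrite ty e_irr.
Qed.

End Helly.

(** The highest node of the set whose highest node is lowest belongs to all
    the others: from a common node, climb to it. *)
Lemma helly (I : finType) (i0 : I) (F : I -> pred T) :
  (forall i, connected_in (F i)) ->
  (forall i j, exists t, F i t && F j t) -> exists t, forall i, F i t.
Proof.
move=> cF iF; have [rk [p [rkI pP]]] := acyclic_parent.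
have topP i : exists m, F i m && [forall s, F i s ==> (rk m <= rk s)].
  have [t /andP[ti _]] := iF i i.
  case: (arg_minnP rk ti) => m mi mmin; exists m; rewrite mi /=.
  by apply/forallP=> s; apply/implyP; apply: mmin.
pose top i := xchoose (topP i).
have top_in i : F i (top i) by have /andP[] := xchooseP (topP i).
have top_min i s : F i s -> rk (top i) <= rk s.
  by have /andP[_ /forallP/(_ s)/implyP] := xchooseP (topP i).
case: (@arg_maxnP _ i0 predT (fun i => rk (top i)) isT) => k _ kmax.
exists (top k) => i; have [u /andP[uk ui]] := iF k i.
elim: {u}(rk u) {-2}u (leqnn (rk u)) uk ui => [|n IHn] u run uk ui.
  suff -> : top k = u by [].
  by apply: rkI; apply/eqP; rewrite eqn_leq top_min //= (leq_trans run).
have [<- //|utop] := eqVneq u (top k).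
have [pk rpu] := parent_in rkI pP (cF k) (top_in k) uk (@top_min k) utop.
have uti : u != top i.
  apply: contraL rpu => /eqP ui'; rewrite -leqNgt ui'.
  by apply: leq_trans (kmax i isT) _; rewrite -ui' top_min.
have [pi _] := parent_in rkI pP (cF i) (top_in i) ui (@top_min i) uti.
by apply: (IHn (p u)) => //; rewrite -ltnS (leq_trans rpu).
Qed.

End Acyclic.

(** The elements of this bramble are stars, which is all that is needed below:
    the nodes whose bags meet a star form a connected set of nodes. *)
Lemma bramble_bag (G : sgraph) (D : treedec G) (I : finType) (i0 : I)
    (hub : I -> G) (leaves : I -> seq G) :
  (forall i, all (edge (hub i)) (leaves i)) ->
  (forall i j, exists x y, [/\ x \in hub i :: leaves i,
     y \in hub j :: leaves j & (x == y) || edge x y]) ->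
  exists t : td_tree D, forall i, has (mem (bag t)) (hub i :: leaves i).
Proof.
move=> star touch; have [_ _ acyc] := td_treeP D.
pose F i := [pred t : td_tree D | has (mem (bag t)) (hub i :: leaves i)].
have cF i : connected_in (@edge (td_tree D)) (F i).
  rewrite /F; move: (star i); elim: (leaves i) => [_|x s IHs /= /andP[hx hs]].
    move=> s t /=; rewrite !orbF => hs ht.
    apply: connect_sub (bag_connected hs ht) => a b /= ab.
    by apply: connect1; rewrite /= !orbF.
  have [u /fintype.subsetP uP] := bag_edge D hx.
  have cx : connected_in (@edge (td_tree D)) [pred t | x \in bag t].
    by move=> a b; apply: bag_connected.
  have xu : x \in bag u by apply: uP; rewrite !inE eqxx orbT.
  have hu : has (mem (bag u)) (hub i :: s) by rewrite /= uP ?inE ?eqxx.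
  have := @connected_inU _ _ [pred t | x \in bag t] _ u xu hu cx (IHs hs).
  congr connected_in; apply: boolp.funext => t /=; exact: orbCA.
apply: (helly (@edge_sym _) (@edge_irr _) acyc i0 cF) => i j.
have [x [y [xi yj xy]]] := touch i j.
suff : exists t : td_tree D, has (mem (bag t)) (hub i :: leaves i) &&
    has (mem (bag t)) (hub j :: leaves j) by [].
case/orP: xy => [/eqP xy|exy].
  have [t xt] := bag_vertex D x; exists t.
  by apply/andP; split; apply/hasP; exists x => //; rewrite xy.
have [t /fintype.subsetP tP] := bag_edge D exy; exists t.
by apply/andP; split; apply/hasP; [exists x|exists y] => //; apply: tP; rewrite !inE eqxx ?orbT.
Qed.

(** * Trees given by parent functions *)

Section ParentTree.
Variables (n : nat) (p : nat -> nat).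
Hypothesis p_lt : forall i, 0 < i -> p i < i.

Definition parent_rel : rel 'I_n.+1 := fun i j =>
  (0 < i) && (p i == j) || (0 < j) && (p j == i).

Lemma parent_rel_sym : symmetric parent_rel.
Proof. by move=> i j; rewrite /parent_rel orbC. Qed.

Lemma parent_rel_irr : irreflexive parent_rel.
Proof.
move=> i; rewrite /parent_rel orbb.
by apply/negP => /andP[/p_lt pi /eqP E]; rewrite E ltnn in pi.
Qed.

Definition parent_tree := SGraph parent_rel_sym parent_rel_irr.

Lemma parent_relP i j : parent_rel i j -> j < i -> p i = j.
Proof.
case/orP=> /andP[/p_lt pi /eqP E] //.
by rewrite -E ltnNge (ltnW pi).
Qed.

(** In a cycle, both neighbours of the largest vertex would be its parent. *)
Lemma parent_treeP : is_tree parent_tree.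
Proof.
split; first by rewrite card_ord.
  suff to0 s : connect parent_rel s ord0.
    move=> s t; apply: connect_trans (to0 s) _.
    by rewrite (sym_connect_sym parent_rel_sym) to0.
  case: s => k; have [m] := ubnP k; elim: m k => // m IHm [|k] km kn.
    by apply: eq_connect0; apply: val_inj.
  have pk := p_lt (ltn0Sn k).
  have pn : p k.+1 < n.+1 by apply: ltn_trans pk kn.
  apply: connect_trans (IHm (p k.+1) _ pn); last exact: leq_trans pk _.
  by apply: connect1; rewrite /parent_rel /= eqxx.
move=> c c2 uc.
have [i ic imax] : exists2 i, i \in c & forall j, j \in c -> j <= i.
  case: c c2 {uc} => // x c _.
  have xx : x \in x :: c by rewrite inE eqxx.
  case: (@arg_maxnP _ x (mem (x :: c)) val xx) => i ic imax.
  by exists i => // j; apply: imax.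
have [k q E] := rot_to ic.
have := uc; rewrite -(rot_ucycle k) E => /andP[/= cy /andP[iq uq]].
have : 1 < size q by rewrite -ltnS -[(size q).+1]/(size (i :: q)) -E size_rot.
have memq j : j \in q -> j < i.
  move=> jq; have : j \in c by rewrite -(mem_rot k) E inE jq orbT.
  move/imax; rewrite leq_eqVlt => /orP[/eqP/val_inj ji|//].
  by move: iq; rewrite -ji jq.
case/lastP: q => [//|q l] in cy iq uq memq E *.
case: q => [|j q] //= in cy iq uq memq E * => _.
move: cy => /andP[eij]; rewrite rcons_path last_rcons => /andP[_ eli].
have := parent_relP eij (memq j (mem_head _ _)).
rewrite parent_rel_sym in eli.
have lq : l \in j :: rcons q l by rewrite inE mem_rcons mem_head orbT.
rewrite (parent_relP eli (memq l lq)) => /val_inj lj.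
by move: uq; rewrite -lj /= mem_rcons mem_head.
Qed.

(** The nodes whose bags contain a given vertex are connected as soon as all
    but one of them have their parent among them. *)
Lemma parent_connected (S : pred nat) (r : nat) :
  (forall i, i < n.+1 -> S i -> i != r -> (0 < i) && S (p i)) ->
  forall s t : 'I_n.+1, S s -> S t ->
    connect [rel a b | [&& parent_rel a b, S a & S b]] s t.
Proof.
move=> Sp; pose e := [rel a b : 'I_n.+1 | [&& parent_rel a b, S a & S b]].
have e_sym : symmetric e by move=> a b; rewrite /= parent_rel_sym [S a && S b]andbC.
have toR (s : 'I_n.+1) : S s -> exists2 u : 'I_n.+1, val u = r & connect e s u.
  case: s => k; have [m] := ubnP k; elim: m k => // m IHm k km kn Sk.
  have [<-|kr] := eqVneq k r; first by exists (Ordinal kn).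
  have /andP[k0 Spk] := Sp k kn Sk kr.
  have pn : p k < n.+1 by apply: ltn_trans (p_lt k0) kn.
  have [||u ur cu] := IHm (p k) _ pn => //.
    exact: leq_trans (p_lt k0) _.
  exists u => //; apply: connect_trans cu; apply: connect1.
  by rewrite /= /parent_rel /= k0 eqxx Sk.
move=> s t /toR[u ur su] /toR[v vr tv].
have uv : u = v by apply: val_inj; rewrite ur.
apply: connect_trans su _; rewrite uv.
by rewrite (sym_connect_sym e_sym).
Qed.

End ParentTree.

(** * The graph *)

(** The vertices are numbers: 0 to 4 are the core vertices A, B, C, D, E, the
    next ten form the clique, two for each key, and the rest are the link
    vertices of the five keys in turn. *)
Definition core_edges : seq (nat * nat) :=
  [:: (0, 1); (0, 2); (0, 3); (1, 2); (1, 3); (2, 4); (3, 4)].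

Definition key (k : nat) : seq nat :=
  nth [::] [:: [:: 0; 4]; [:: 1; 4]; [:: 2; 3]; [:: 0; 1; 2]; [:: 0; 1; 3]] k.
Definition clique_part (k : nat) : seq nat := iota (5 + k.*2) 2.
Definition link_part (k : nat) : seq nat :=
  nth [::] [:: iota 15 4; iota 19 4; iota 23 3; iota 26 3; iota 29 3] k.

Definition edge_list : seq (nat * nat) :=
  core_edges ++ [seq ij <- [seq (i, j) | i <- iota 5 10, j <- iota 5 10] | ij.1 < ij.2]
  ++ flatten [seq [seq (y, v) | y <- link_part k, v <- key k ++ clique_part k]
             | k <- iota 0 5].

Definition adj (i j : nat) := ((i, j) \in edge_list) || ((j, i) \in edge_list).

Lemma adj_sym : symmetric adj.
Proof. by move=> i j; rewrite /adj orbC. Qed.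

Lemma edge_list_irr : all (fun ij => ij.1 != ij.2) edge_list.
Proof. by vm_compute. Qed.

Lemma adj_irr : irreflexive adj.
Proof.
by move=> i; rewrite /adj orbb; apply/negP => /(allP edge_list_irr)/eqP.
Qed.

Definition adj32 : rel 'I_32 := fun x y => adj x y.
Lemma adj32_sym : symmetric adj32. Proof. by move=> x y; apply: adj_sym. Qed.
Lemma adj32_irr : irreflexive adj32. Proof. by move=> x; apply: adj_irr. Qed.

Definition G32 := SGraph adj32_sym adj32_irr.

Definition idx (x : G32) : nat := x : 'I_32.
Definition vtx (i : nat) : G32 := inord i : 'I_32.

Lemma idx_inj : injective idx. Proof. exact: val_inj. Qed.
Lemma idx_lt x : idx x < 32. Proof. exact: (ltn_ord (x : 'I_32)). Qed.
Lemma vtxK i : i < 32 -> idx (vtx i) = i. Proof. exact: inordK. Qed.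
Lemma idxK : cancel idx vtx. Proof. by move=> x; apply: (@inord_val 31). Qed.

Definition vset (s : seq nat) : {set G32} := [set x | idx x \in s].

Lemma in_vset (s : seq nat) (x : G32) : (x \in vset s) = (idx x \in s).
Proof. by rewrite inE. Qed.

Lemma vsetS (s1 s2 : seq nat) : all (mem s2) s1 -> vset s1 \subset vset s2.
Proof.
by move=> /allP s12; apply/fintype.subsetP => x; rewrite !in_vset; apply: s12.
Qed.

Lemma vset_cat (s1 s2 : seq nat) : vset (s1 ++ s2) = vset s1 :|: vset s2.
Proof. by apply/setP => x; rewrite !inE mem_cat. Qed.

Lemma vset_pair (x y : G32) : [set x; y]%SET = vset [:: idx x; idx y].
Proof. by apply/setP => z; rewrite !inE !(inj_eq idx_inj). Qed.

Lemma sum_vset (V : nmodType) (w : nat -> V) (s : seq nat) :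
  uniq s -> all (fun i => i < 32) s ->
  (\sum_(x in vset s) w (idx x) = \sum_(i <- s) w i)%R.
Proof.
move=> us /allP s32.
pose e := [seq vtx i | i <- s].
have ve : [seq idx x | x <- e] = s.
  by rewrite -map_comp map_id_in // => i /s32 i32; rewrite /= vtxK.
have ue : uniq e by rewrite -(map_inj_uniq idx_inj) ve.
rewrite -[in RHS]ve big_map (big_uniq _ ue) /=; apply: eq_bigl => x.
by rewrite in_vset -{1}ve (mem_map idx_inj).
Qed.

Lemma G32_no_isolated : no_isolated G32.
Proof.
have /allP E : all (fun i => has (adj i) (iota 0 32)) (iota 0 32) by vm_compute.
move=> x; have := E (idx x); rewrite mem_iota idx_lt => /(_ isT)/hasP[j].
rewrite mem_iota => /= j32 xj; exists (vtx j).
by change (adj (idx x) (idx (vtx j))); rewrite vtxK.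
Qed.

(** * A decomposition for each key *)

(** A decidable form of the axioms of a tree decomposition with bags [B] on a
    tree given by parents, so that the decompositions below are verified by
    computation; [r] is the highest bag with [x] in it. *)
Definition valid_decomposition (p : nat -> nat) (B : nat -> seq nat) (n : nat) :=
  all (fun ij => has (fun t => (ij.1 \in B t) && (ij.2 \in B t)) (iota 0 n.+1))
    edge_list &&
  all (fun x => has (fun r => (x \in B r) &&
      all (fun i => (x \in B i) ==> (i == r) || (0 < i) && (x \in B (p i)))
        (iota 0 n.+1)) (iota 0 n.+1)) (iota 0 32).

Lemma treedec_of_valid p B n : (forall i, 0 < i -> p i < i) ->
  valid_decomposition p B n ->
  exists D : treedec G32, forall t : td_tree D,
    exists2 i, i <= n & bag t = vset (B i).
Proof.
move=> p_lt /andP[/allP edgeP /allP vertP].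
pose b (t : parent_tree n p_lt) : {set G32} := vset (B (val t)).
have bE (x y : G32) : edge x y -> exists t, ([set x; y]%SET \subset b t).
  have bE' i j : (i, j) \in edge_list -> exists t, (vset [:: i; j] \subset b t).
    move/edgeP=> /hasP[t]; rewrite mem_iota => /= tn /andP[it jt].
    by exists (Ordinal tn : 'I_n.+1); apply: vsetS => /=; rewrite it jt.
  case/orP=> /bE'[t tP]; exists t; rewrite vset_pair //.
  by apply: fintype.subset_trans tP; apply: vsetS; rewrite /= !inE !eqxx orbT.
have rootP (x : G32) : exists2 r, r < n.+1 & (idx x \in B r) /\
    forall i, i < n.+1 -> idx x \in B i -> i != r -> (0 < i) && (idx x \in B (p i)).
  have := vertP (idx x); rewrite mem_iota idx_lt => /(_ isT)/hasP[r rI /andP[xr /allP rP]].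
  have rn : r < n.+1 by move: rI; rewrite mem_iota.
  exists r => //; split=> // i ni xi.
  by have := rP i; rewrite mem_iota xi => /(_ ni); case: eqP.
have bV (x : G32) : exists t, x \in b t.
  by have [r rn [xr _]] := rootP x; exists (Ordinal rn : 'I_n.+1); rewrite in_vset.
have bC (x : G32) (s t : parent_tree n p_lt) : x \in b s -> x \in b t ->
    connect [rel a c | [&& edge a c, x \in b a & x \in b c]] s t.
  have [r rn [xr rP]] := rootP x.
  rewrite !in_vset => xs xt.
  have := @parent_connected n p p_lt (fun i => idx x \in B i) r rP s t xs xt.
  by apply: connect_sub => u v /=; rewrite -!in_vset => uv; apply: connect1.
exists (TreeDec (parent_treeP n p_lt) bE bV bC) => t /=.
by exists (val t) => //; rewrite -ltnS ltn_ord.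
Qed.

(** The decomposition for key [k] is a path of three bags, starting with the
    union of [key k] and the clique, plus one leaf for each link vertex.  Once
    the link vertices of [key k] are cut off, its two clique vertices can be
    dropped, which leaves room for two more core vertices; after the next drop
    the whole core fits.  The two bags that arise are defined through at most
    six edges that cover them. *)
Definition second_cover (k : nat) : seq (nat * nat) :=
  nth [::] [:: [:: (0, 2); (3, 4)]; [:: (1, 2); (3, 4)]; [:: (0, 2); (1, 3)];
               [:: (0, 2); (1, 3)]; [:: (0, 2); (1, 3)]] k
  ++ [seq (5 + l.*2, 6 + l.*2) | l <- iota 0 5 & l != k].
Definition third_cover (k : nat) : seq (nat * nat) :=
  [:: (0, 1); (2, 4); (0, 3)] ++ [seq (5 + l.*2, 6 + l.*2) | l <-
    nth [::] [:: [:: 1; 3; 4]; [:: 0; 3; 4]; [:: 0; 1]; [:: 0; 1]; [:: 0; 1]] k].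
Definition ends (M : seq (nat * nat)) := flatten [seq [:: ij.1; ij.2] | ij <- M].

Definition link_type (y : nat) := find (fun k => y \in link_part k) (iota 0 5).
Definition leaf_cover (y : nat) : seq (nat * nat) :=
  [seq (y, v) | v <- key (link_type y)] ++
  [:: (5 + (link_type y).*2, 6 + (link_type y).*2)].

Definition dec_bag (k i : nat) : seq nat :=
  match i with
  | 0 => key k ++ iota 5 10
  | 1 => ends (second_cover k)
  | 2 => ends (third_cover k)
  | _ => ends (leaf_cover (i + 12))
  end.
Definition dec_parent (k i : nat) : nat :=
  match i with
  | 0 | 1 => 0
  | 2 => 1
  | _ => minn 2 (find (fun t => all (mem (dec_bag k t))
           (key (link_type (i + 12)) ++ clique_part (link_type (i + 12)))) (iota 0 2))
  end.
Definition dec_cover (k i : nat) : seq (nat * nat) :=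
  match i with
  | 0 => [::]
  | 1 => second_cover k
  | 2 => third_cover k
  | _ => leaf_cover (i + 12)
  end.

Lemma dec_parent_lt k i : 0 < i -> dec_parent k i < i.
Proof. by case: i => [|[|[|i]]] // _; rewrite /dec_parent gtn_min. Qed.

Lemma dec_valid k : k < 5 -> valid_decomposition (dec_parent k) (dec_bag k) 19.
Proof.
suff /allP E : all (fun k => valid_decomposition (dec_parent k) (dec_bag k) 19) (iota 0 5).
  by move=> k5; apply: E; rewrite mem_iota.
by vm_compute.
Qed.

Lemma dec_cover_small k i : k < 5 -> 0 < i <= 19 ->
  (size (dec_cover k i) <= 6) &&
  all (fun ij => [&& adj ij.1 ij.2, ij.1 < 32 & ij.2 < 32]) (dec_cover k i).
Proof.
suff /allP E : all (fun k => all (fun i => (size (dec_cover k i) <= 6) &&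
    all (fun ij => [&& adj ij.1 ij.2, ij.1 < 32 & ij.2 < 32]) (dec_cover k i)) (iota 1 19)) (iota 0 5).
  move=> k5 i19; have kI : k \in iota 0 5 by rewrite mem_iota.
  by have /allP Ek := E k kI; apply: Ek; rewrite mem_iota.
by vm_compute.
Qed.

Local Open Scope ring_scope.

(** * Width of an edge dominated polymatroid *)

Section Upper.
Context {R : realType}.
Implicit Types h : {set G32} -> R.

Lemma polymatroid_subadd (V : finType) (h : {set V} -> R) U W :
  polymatroid h -> h (U :|: W)%SET <= h U + h W.
Proof.
case=> h0 _ _ hsub; apply: le_trans (hsub U W).
by rewrite lerDl.
Qed.

Lemma edge_le1 h i j : edge_dominated h -> adj i j -> (i < 32)%N -> (j < 32)%N ->
  h (vset [:: i; j]) <= 1.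
Proof.
move=> [_ hE] ij i32 j32; have := hE (vtx i) (vtx j).
rewrite vset_pair !vtxK //; apply.
by change (adj (idx (vtx i)) (idx (vtx j))); rewrite !vtxK.
Qed.

Lemma cover_bound h (M : seq (nat * nat)) U : polymatroid h -> edge_dominated h ->
  all (fun ij => [&& adj ij.1 ij.2, (ij.1 < 32)%N & (ij.2 < 32)%N]) M ->
  h (U :|: vset (ends M))%SET <= h U + (size M)%:R.
Proof.
move=> hP hE; elim: M U => [|[i j] M IHM] U /=.
  have -> : vset [::] = finset.set0 by apply/setP => x; rewrite !inE.
  by rewrite addr0 finset.setU0.
case/andP=> /and3P[ij i32 j32] /IHM le_M.
rewrite (vset_cat [:: i; j]) finset.setUA.
apply: le_trans (le_M _) _; rewrite -natr1.
have := polymatroid_subadd U (vset [:: i; j]) hP.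
by have := edge_le1 hE ij i32 j32; lra.
Qed.

(** All bags but the first are covered by six edges, hence have value at most 6;
    in the first one the clique is covered by five edges. *)
Lemma width_le_key h (k : nat) : polymatroid h -> edge_dominated h -> (k < 5)%N ->
  width h <= Num.max 6 (h (vset (key k)) + 5).
Proof.
move=> hP hE k5.
have [D DP] := treedec_of_valid (dec_parent_lt k) (dec_valid k5).
have [_ /(_ D) le_D] := width_attained h.
apply: le_trans le_D _; apply/bigmax_leP; split.
  by rewrite le_max ler0n.
move=> t _; have [i i19 ->] := DP t.
case: i => [|i] in i19 *.
  rewrite le_max; apply/orP; right; rewrite [dec_bag k 0]/(key k ++ iota 5 10) vset_cat.
  exact: (@cover_bound h [seq (5 + l.*2, 6 + l.*2)%N | l <- iota 0 5]).
rewrite le_max; apply/orP; left.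
have /andP[sz cov] := @dec_cover_small k i.+1 k5 i19.
have -> : dec_bag k i.+1 = ends (dec_cover k i.+1) by case: i {i19 sz cov} => [|[]].
have := @cover_bound h _ finset.set0 hP hE cov.
rewrite finset.set0U => /le_trans; apply.
by case: hP => _ -> _ _; rewrite add0r ler_nat.
Qed.

Lemma width_le h (s : R) : 1 <= s -> polymatroid h -> edge_dominated h ->
  (exists2 k, (k < 5)%N & h (vset (key k)) <= s) -> width h <= s + 5.
Proof.
move=> s1 hP hE [k k5 hk]; apply: le_trans (width_le_key hP hE k5) _.
by rewrite ge_max; apply/andP; split; lra.
Qed.

End Upper.

(** Stars of the core, given as a hub with leaves.  Their minimal transversals
    are the keys. *)
Definition core_stars : seq (nat * seq nat) :=
  [:: (4, [:: 2; 3]); (2, [:: 4; 0]); (2, [:: 4; 1]); (3, [:: 4; 0]);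
      (3, [:: 4; 1]); (0, [:: 1; 2]); (0, [:: 1; 3])]%N.
Definition link_stars : seq (nat * seq nat) :=
  flatten [seq [seq (z, [:: y]) | z <- clique_part k, y <- link_part k] | k <- iota 0 5].
Definition stars := core_stars ++ link_stars.

Definition star_verts (b : nat * seq nat) := b.1 :: b.2.

Lemma stars_adj : all (fun b => all (adj b.1) b.2) stars.
Proof. by vm_compute. Qed.

Lemma stars_lt : all (fun b => all (fun i => i < 32)%N (star_verts b)) stars.
Proof. by vm_compute. Qed.

Lemma stars_touch : all (fun b => all (fun c =>
   has (fun i => has (fun j => (i == j) || adj i j) (star_verts c)) (star_verts b))
   stars) stars.
Proof. by vm_compute. Qed.

Lemma stars_bag (D : treedec G32) : exists t : td_tree D,
  forall b, b \in stars -> has (fun i => vtx i \in bag t) (star_verts b).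
Proof.
have n0 : (0 < size stars)%N by vm_compute.
pose sb (i : 'I_(size stars)) := nth (0%N, [::]) stars i.
have sbI i : sb i \in stars by rewrite mem_nth.
have [||t tP] := @bramble_bag G32 D _ (Ordinal n0) (fun i => vtx (sb i).1)
    (fun i => [seq vtx v | v <- (sb i).2]).
- move=> i; rewrite all_map; apply/allP => v vi.
  have /allP/(_ v vi) := allP stars_adj _ (sbI i).
  have /andP[h32 /allP/(_ v vi) v32] := allP stars_lt _ (sbI i).
  by move=> a; change (adj (idx (vtx (sb i).1)) (idx (vtx v))); rewrite !vtxK.
- move=> i j.
  have /hasP[x xi /hasP[y yj xy]] := allP (allP stars_touch _ (sbI i)) _ (sbI j).
  have x32 := allP (allP stars_lt _ (sbI i)) _ xi.
  have y32 := allP (allP stars_lt _ (sbI j)) _ yj.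
  exists (vtx x), (vtx y); split.
  + exact: (map_f vtx xi).
  + exact: (map_f vtx yj).
  + case/orP: xy => [/eqP->|xy]; first by rewrite eqxx.
    apply/orP; right; change (adj (idx (vtx x)) (idx (vtx y))).
    by rewrite !vtxK.
exists t => b /(nthP (0%N, [::]))[i i_lt bi].
have := tP (Ordinal i_lt); rewrite /sb /= bi has_map /=.
by [].
Qed.

(** The bramble consists of the core stars and all edges between the clique and
    the link vertices.  A bag that misses a clique vertex of some key must meet
    all these edges at the other end, so it contains the whole link part. *)
Lemma key_bag (D : treedec G32) : exists t : td_tree D,
  (exists2 k, (k < 5)%N & vset (key k) \subset bag t) /\
  forall k, (k < 5)%N ->
    (vset (clique_part k) \subset bag t) \/ (vset (link_part k) \subset bag t).
Proof.
have [t tP] := stars_bag D; exists t; pose m i := vtx i \in bag t.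
have sub s : all m s -> vset s \subset bag t.
  move=> /allP sm; apply/fintype.subsetP => x; rewrite in_vset => /sm.
  by rewrite /m idxK.
split; last first.
  move=> k k5; have [mz|] := boolP (all m (clique_part k)); first by left; apply: sub.
  case/allPn=> z zk zt; right; apply: sub; apply/allP => y yk.
  have : (z, [:: y]) \in stars.
    rewrite mem_cat; apply/orP; right; apply/flattenP.
    exists [seq (z, [:: y]) | z <- clique_part k, y <- link_part k].
      by apply: (map_f (fun k => [seq (z, [:: y]) | z <- clique_part k, y <- link_part k]));
         rewrite mem_iota.
    by apply/allpairsP; exists (z, y).
  move/tP; rewrite /= -/(m z) -/(m y) orbF.
  by rewrite (negbTE zt).
have : all (fun b => has m (star_verts b)) core_stars.
  by apply/allP => b bc; apply: tP; rewrite mem_cat bc.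
have keyP k : all m (key k) && (k < 5)%N ->
    exists2 k, (k < 5)%N & vset (key k) \subset bag t.
  by case/andP=> mk k5; exists k => //; apply: sub.
rewrite /= /star_verts /=.
case m0 : (m 0%N); case m1 : (m 1%N); case m2 : (m 2%N); case m3 : (m 3%N);
  case m4 : (m 4%N) => //= _;
  (try by apply: (keyP 0%N); rewrite /= ?m0 ?m1 ?m2 ?m3 ?m4);
  (try by apply: (keyP 1%N); rewrite /= ?m0 ?m1 ?m2 ?m3 ?m4);
  (try by apply: (keyP 2%N); rewrite /= ?m0 ?m1 ?m2 ?m3 ?m4);
  (try by apply: (keyP 3%N); rewrite /= ?m0 ?m1 ?m2 ?m3 ?m4);
  (try by apply: (keyP 4%N); rewrite /= ?m0 ?m1 ?m2 ?m3 ?m4).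
Qed.

(** The weight of a vertex outside the core, such that each of the five clique
    parts and of the five link parts has weight 1; it is multiplied by twelve to
    be a natural number. *)
Definition weight12 (i : nat) : nat :=
  if (i < 5)%N then 0 else if (i < 15)%N then 6 else if (i < 23)%N then 3 else 4.
(** Twelve times the largest value of a core vertex that the edges to its link
    neighbours, of weight 1/3 or 1/4, leave room for. *)
Definition cap12 (i : nat) : nat := if i == 4%N then 9 else 8.

(** Whatever [c] chooses, five parts of weight 1 each are taken. *)
Lemma transversal_weight (c : nat -> bool) :
  let L := flatten [seq if c k then clique_part k else link_part k | k <- iota 0 5] in
  [/\ uniq L, all (fun i => i < 32)%N L & (\sum_(i <- L) weight12 i = 60)%N].
Proof.
rewrite /=; case: (c 0%N); case: (c 1%N); case: (c 2%N); case: (c 3%N); case: (c 4%N);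
  by split; [vm_compute | vm_compute | rewrite unlock; vm_compute].
Qed.

(** The clique and link vertices are independent of everything else, so outside
    the core only the weights at the two ends of an edge matter. *)
Lemma edge_cases : all (fun ij => let: (i, j) := ij in
   [|| ij \in core_edges,
       [&& 5 <= i, 5 <= j & weight12 i + weight12 j <= 12] |
       [&& 5 <= i, j < 5 & weight12 i + cap12 j <= 12] ])%N edge_list.
Proof. by vm_compute. Qed.

Section Lower.
Context {R : realType}.
Variable F : bool -> bool -> bool -> bool -> bool -> R.

Definition core_fun (U : {set G32}) : R :=
  F (vtx 0 \in U) (vtx 1 \in U) (vtx 2 \in U) (vtx 3 \in U) (vtx 4 \in U).

Definition padding (U : {set G32}) : R := \sum_(x in U) (weight12 (idx x))%:R / 12.

Lemma in_vsetE i s : (i < 32)%N -> (vtx i \in vset s) = (i \in s).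
Proof. by move=> i32; rewrite in_vset vtxK. Qed.

Lemma padding_vset s : uniq s -> all (fun i => i < 32)%N s ->
  padding (vset s) = (\sum_(i <- s) weight12 i)%:R / 12.
Proof.
move=> us s32; rewrite /padding (sum_vset (fun i => (weight12 i)%:R / 12)) //.
by rewrite -big_distrl /= natr_sum.
Qed.

Lemma paddingS (U W : {set G32}) : U \subset W -> padding U <= padding W.
Proof.
move=> /finset.setIidPr UW; rewrite [leRHS](big_setID U) /= UW lerDl.
by apply: sumr_ge0 => x _; rewrite divr_ge0 ?ler0n.
Qed.

Lemma width_ge (s : R) :
  {homo core_fun : U W / U \subset W >-> U <= W} ->
  (forall k, (k < 5)%N -> s <= core_fun (vset (key k))) ->
  s + 5 <= width (fun U => core_fun U + padding U).
Proof.
move=> mono keyF; have [[D ->] _] := width_attained (fun U => core_fun U + padding U).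
have [t [[k k5 kt] parts]] := key_bag D.
apply: le_trans (le_bigmax _ _ t); apply: lerD.
  by apply: le_trans (keyF k k5) _; apply: mono.
have [c cP] : exists c : nat -> bool, forall k, (k < 5)%N ->
    vset (if c k then clique_part k else link_part k) \subset bag t.
  exists (fun k => vset (clique_part k) \subset bag t) => l /parts.
  by case: ifP => // _ [].
have [uL L32 sL] := transversal_weight c.
set L := flatten _ in uL L32 sL.
have -> : 5 = padding (vset L) by rewrite padding_vset // sL; lra.
apply: paddingS; apply/fintype.subsetP => x; rewrite in_vset => /flattenP[q].
case/mapP=> l; rewrite mem_iota => /= l5 -> xl.
by apply: (fintype.subsetP (cP l l5)); rewrite in_vset.
Qed.

Lemma edge_dominatedP :
  (forall U, 0 <= core_fun U) ->
  F false false false false false = 0 ->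
  (forall i, (i < 5)%N -> core_fun (vset [:: i]) <= (cap12 i)%:R / 12) ->
  (forall i j, (i, j) \in core_edges -> core_fun (vset [:: i; j]) <= 1) ->
  edge_dominated (fun U => core_fun U + padding U).
Proof.
move=> F0 FF cap core; split.
  move=> U; apply: addr_ge0; [exact: F0 | apply: sumr_ge0 => x _].
  by rewrite divr_ge0 ?ler0n.
move=> x y xy; rewrite vset_pair.
have : adj (idx x) (idx y) by [].
have {xy} : (idx x < 32)%N && (idx y < 32)%N by rewrite !idx_lt.
suff main i j : (i, j) \in edge_list -> (i < 32)%N -> (j < 32)%N ->
    core_fun (vset [:: i; j]) + padding (vset [:: i; j]) <= 1.
  case/andP=> x32 y32 /orP[|yx]; first by move=> xy; apply: main.
  have -> : vset [:: idx x; idx y] = vset [:: idx y; idx x].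
    by apply/setP => z; rewrite !in_vset !inE orbC.
  exact: main.
move=> ij i32 j32; rewrite padding_vset /=; last 2 first.
- by rewrite inE andbT; exact: (allP edge_list_irr _ ij).
- by rewrite i32 j32.
rewrite !big_cons big_nil addn0.
have hi k : (5 <= k)%N -> forall s l, core_fun (vset (rcons s k)) = core_fun (vset s) /\
     core_fun (vset [:: k]) = 0 /\ core_fun (vset [:: k; l]) = core_fun (vset [:: l]).
  move=> k5 s l.
  have nk l' : (l' < 5)%N -> (l' == k) = false by move=> l5; apply/eqP => E; rewrite E ltnNge k5 in l5.
  by rewrite /core_fun !in_vsetE // !mem_rcons !inE !nk.
case/or3P: (allP edge_cases _ ij) => [ijc|/and3P[i5 j5 wij]|/and3P[i5 j5 wij]].
- have w0 : all (fun ij => (weight12 ij.1 == 0)%N && (weight12 ij.2 == 0)%N) core_edges by [].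
  have /andP[/eqP /= -> /eqP ->] := allP w0 _ ijc.
  by rewrite addn0 mul0r addr0; apply: core.
- have [_ [_ ->]] := hi i i5 [::] j; have [_ [-> _]] := hi j j5 [::] j.
  by rewrite add0r ler_pdivrMr // mul1r ler_nat.
- have [_ [_ ->]] := hi i i5 [::] j.
  have -> : weight12 j = 0%N by rewrite /weight12 j5.
  have := cap j j5.
  have : (weight12 i + cap12 j)%:R <= 12 :> R by rewrite ler_nat.
  by rewrite addn0 natrD; lra.
Qed.

End Lower.

(** * Linear inequalities on set functions *)

Section LinearForms.
Context {R : realType} {V : finType}.
Implicit Types (h g : {set V} -> R) (l : seq (R * {set V})).

Definition lform l h : R := \sum_(p <- l) p.1 * h p.2.

(** On a finite ground set this is membership in the pointwise closure. *)
Definition approximable (C : ({set V} -> R) -> Prop) h :=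
  forall e, 0 < e -> exists2 g, C g & forall U, `|h U - g U| < e.

Lemma lform_sum (I : Type) (r : seq I) (c : I -> R) (g : I -> {set V} -> R) l :
  lform l (fun U => \sum_(i <- r) c i * g i U) = \sum_(i <- r) c i * lform l (g i).
Proof.
rewrite /lform; under eq_bigr do rewrite big_distrr /=.
rewrite exchange_big /=; apply: eq_bigr => i _; rewrite big_distrr /=.
by apply: eq_bigr => p _; rewrite mulrCA.
Qed.

Lemma approx_lform_ge0 C l h : approximable C h ->
  (forall g, C g -> 0 <= lform l g) -> 0 <= lform l h.
Proof.
move=> Ch Cl; pose S := \sum_(p <- l) `|p.1|.
have S0 : 0 <= S by apply: sumr_ge0.
apply/ler_addgt0Pr => e e0.
have S1 : 0 < S + 1 by lra.
have [g Cg gh] := Ch _ (divr_gt0 e0 S1).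
have := Cl _ Cg; suff : lform l g - lform l h <= e by lra.
rewrite /lform -sumrB; apply: (@le_trans _ _ (\sum_(p <- l) `|p.1| * (e / (S + 1)))).
  apply: ler_sum => p _; rewrite -mulrBr; apply: le_trans (ler_norm _) _.
  by rewrite normrM ler_wpM2l // ltW // distrC.
rewrite -big_distrl /= -/S mulrCA ler_piMr ?ltW //.
by rewrite ltr_pdivrMr // mul1r; lra.
Qed.

Lemma polymatroid_approx C h : approximable C h -> (forall g, C g -> polymatroid g) ->
  polymatroid h.
Proof.
move=> Ch CP.
have F l := @approx_lform_ge0 C l h Ch.
have lf1 a A f : lform [:: (a, A)] f = a * f A by rewrite /lform big_seq1.
have lf2 a A b B f : lform [:: (a, A); (b, B)] f = a * f A + b * f B.
  by rewrite /lform big_cons big_seq1.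
have h0 U : 0 <= h U.
  have := F [:: (1, U)]; rewrite lf1 mul1r; apply=> g /CP[+ _ _ _] => /(_ U).
  by rewrite lf1 mul1r.
split=> //.
- apply/eqP; rewrite eq_le h0 andbT.
  have := F [:: (-1, finset.set0)]; rewrite lf1 => H.
  suff : 0 <= -1 * h finset.set0 by lra.
  by apply: H => g /CP[_ g0 _ _]; rewrite lf1 g0 mulr0.
- move=> U W; have := F [:: (1, (U :|: W)%SET); (-1, U)]; rewrite lf2 => H.
  suff : 0 <= 1 * h (U :|: W)%SET + -1 * h U by lra.
  apply: H => g /CP[_ _ + _] => /(_ U W); rewrite lf2; lra.
- move=> U W; have := F [:: (1, U); (1, W); (-1, (U :|: W)%SET); (-1, (U :&: W)%SET)].
  rewrite /lform !big_cons big_nil /= => H.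
  suff : 0 <= 1 * h U + (1 * h W + (-1 * h (U :|: W)%SET + (-1 * h (U :&: W)%SET + 0))) by lra.
  apply: H => g /CP[_ _ _] => /(_ U W); rewrite !big_cons big_nil /=; lra.
Qed.

Lemma polymatroid_sum (I : Type) (r : seq I) (c : I -> R) (g : I -> {set V} -> R) :
  (forall i, 0 <= c i) -> (forall i, polymatroid (g i)) ->
  polymatroid (fun U => \sum_(i <- r) c i * g i U).
Proof.
move=> c0 gP; split.
- by move=> U; apply: sumr_ge0 => i _; apply: mulr_ge0 => //; case: (gP i).
- by apply: big1 => i _; case: (gP i) => _ -> _ _; rewrite mulr0.
- by move=> U W; apply: ler_sum => i _; apply: ler_wpM2l => //; case: (gP i).
- move=> U W; rewrite -!big_split; apply: ler_sum => i _ /=.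
  by rewrite -!mulrDr ler_wpM2l //; case: (gP i).
Qed.

Lemma stepE (K U : {set V}) : step K U = (U :&: K != finset.set0)%:R :> R.
Proof. by rewrite /step; case: ifP. Qed.

Lemma polymatroid_step (K : {set V}) : polymatroid (step K : {set V} -> R).
Proof.
have sU U W : ((U :|: W) :&: K != finset.set0)%SET =
    (U :&: K != finset.set0) || (W :&: K != finset.set0).
  by rewrite finset.setIUl finset.setU_eq0 negb_and.
split.
- by move=> U; rewrite stepE ler0n.
- by rewrite stepE finset.set0I eqxx.
- by move=> U W; rewrite !stepE ler_nat sU; case: (_ != _).
- move=> U W; rewrite !stepE sU -!natrD ler_nat.
  have [E|_] := boolP ((U :&: W) :&: K != finset.set0)%SET; last first.
    by case: (U :&: K != _); case: (W :&: K != _).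
  have [x] := set0Pn _ E; rewrite !inE => /andP[/andP[xU xW] xK].
  have -> : (U :&: K != finset.set0) by apply/set0Pn; exists x; rewrite inE xU.
  by have -> : (W :&: K != finset.set0) by apply/set0Pn; exists x; rewrite inE xW.
Qed.

Lemma normal_polymatroid h : normal h -> polymatroid h.
Proof.
case=> c [c0 /boolp.funext ->].
by apply: polymatroid_sum => // K; apply: polymatroid_step.
Qed.

Lemma normal_lform_ge0 l h : (forall K, 0 <= lform l (step K)) -> normal h -> 0 <= lform l h.
Proof.
move=> lK [c [c0 /boolp.funext ->]]; rewrite lform_sum.
by apply: sumr_ge0 => K _; apply: mulr_ge0.
Qed.

Lemma normal_step (K : {set V}) : normal (step K : {set V} -> R).
Proof.
exists (fun L => (L == K)%:R); split=> [L|U]; first exact: ler0n.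
by rewrite (bigD1 K) //= eqxx mul1r big1 ?addr0 // => L /negbTE->; rewrite mul0r.
Qed.

Lemma normal_sum (I : Type) (r : seq I) (c : I -> R) (g : I -> {set V} -> R) :
  (forall i, 0 <= c i) -> (forall i, normal (g i)) ->
  normal (fun U => \sum_(i <- r) c i * g i U).
Proof.
move=> c0 /(_ _)/boolp.cid-/all_sig[d dP].
exists (fun K => \sum_(i <- r) c i * d i K); split.
  by move=> K; apply: sumr_ge0 => i _; apply: mulr_ge0 => //; case: (dP i).
move=> U; under [RHS]eq_bigr do rewrite big_distrl /=.
rewrite exchange_big /=; apply: eq_bigr => i _.
case: (dP i) => _ ->; rewrite big_distrr /=.
by apply: eq_bigr => K _; rewrite mulrA.
Qed.

Lemma modular_steps (w : V -> R) (U : {set V}) :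
  \sum_(v <- enum V) w v * step [set v]%SET U = \sum_(v in U) w v.
Proof.
rewrite big_enum /= [LHS](bigID (mem U)) /= [X in _ + X]big1 ?addr0; last first.
  move=> v vU; rewrite stepE (_ : _ :&: _ = finset.set0) ?eqxx ?mulr0 //.
  by apply/setP => x; rewrite !inE; case: eqP => [->|]; rewrite ?(negbTE vU) ?andbF.
apply: eq_bigr => v vU; rewrite stepE.
suff -> : (U :&: [set v]%SET != finset.set0) by rewrite mulr1.
by apply/set0Pn; exists v; rewrite !inE vU eqxx.
Qed.

Lemma modular_normal h : modular h -> normal h.
Proof.
case=> w [w0 hE].
have -> : h = fun U => \sum_(v <- enum V) w v * step [set v]%SET U.
  by apply: boolp.funext => U; rewrite hE modular_steps.
by apply: normal_sum => // v; apply: normal_step.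
Qed.

End LinearForms.

(** * Upper bounds for the keys *)

Section KeyBounds.
Context {R : realType}.
Implicit Types h : {set G32} -> R.

(** If a nonnegative combination of the five key values is at most [s] times the
    sum of its coefficients, then one of the keys has value at most [s]. *)
Lemma key_le h (s : R) (a b c d e : R) :
  0 <= a -> 0 <= b -> 0 <= c -> 0 <= d -> 0 <= e ->
  0 < a + b + c + d + e ->
  a * h (vset [:: 0; 4]) + b * h (vset [:: 1; 4]) + c * h (vset [:: 2; 3])
    + d * h (vset [:: 0; 1; 2]) + e * h (vset [:: 0; 1; 3]) <= (a + b + c + d + e) * s ->
  exists2 k, (k < 5)%N & h (vset (key k)) <= s.
Proof.
move=> a0 b0 c0 d0 e0 pos le_s.
have [?|h0] := leP (h (vset (key 0))) s; first by exists 0%N.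
have [?|h1] := leP (h (vset (key 1))) s; first by exists 1%N.
have [?|h2] := leP (h (vset (key 2))) s; first by exists 2%N.
have [?|h3] := leP (h (vset (key 3))) s; first by exists 3%N.
have [?|h4] := leP (h (vset (key 4))) s; first by exists 4%N.
rewrite /= in h0 h1 h2 h3 h4; exfalso.
have mul x y : 0 <= x -> s < y -> x * s <= x * y by move=> x0 sy; rewrite ler_wpM2l // ltW.
have mulS x y : 0 < x -> s < y -> x * s < x * y by move=> x0 sy; rewrite ltr_pM2l.
have H0 := mul _ _ a0 h0; have H1 := mul _ _ b0 h1; have H2 := mul _ _ c0 h2.
have H3 := mul _ _ d0 h3; have H4 := mul _ _ e0 h4.
have : 0 < a \/ 0 < b \/ 0 < c \/ 0 < d \/ 0 < e.
  have [|] := ltP 0 a; first by left.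
  have [|] := ltP 0 b; first by right; left.
  have [|] := ltP 0 c; first by right; right; left.
  have [|] := ltP 0 d; first by right; right; right; left.
  by move=> *; right; right; right; right; lra.
case=> [/mulS/(_ h0)|[/mulS/(_ h1)|[/mulS/(_ h2)|[/mulS/(_ h3)|/mulS/(_ h4)]]]]; lra.
Qed.

Section Polymatroid.
Variable h : {set G32} -> R.
Hypotheses (hP : polymatroid h) (hE : edge_dominated h).

Lemma vset_subadd s t : h (vset (s ++ t)) <= h (vset s) + h (vset t).
Proof. by rewrite vset_cat; apply: polymatroid_subadd. Qed.

(** Submodularity with the union and intersection written as lists. *)
Lemma vset_submod s t u i : vset u = vset (s ++ t) -> 
  vset i = vset [seq x <- s | x \in t] ->
  h (vset u) + h (vset i) <= h (vset s) + h (vset t).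
Proof.
move=> -> ->; rewrite vset_cat.
have -> : vset [seq x <- s | x \in t] = (vset s :&: vset t)%SET.
  by apply/setP => x; rewrite !inE mem_filter andbC.
by case: hP.
Qed.

Lemma vset_perm s t : s =i t -> vset s = vset t.
Proof. by move=> st; apply/setP => x; rewrite !inE st. Qed.

Let a := h (vset [:: 0]).
Let b := h (vset [:: 1]).
Let c := h (vset [:: 2]).
Let d := h (vset [:: 3]).
Let e := h (vset [:: 4]).
Let ae := h (vset [:: 0; 4]).
Let be := h (vset [:: 1; 4]).
Let cd := h (vset [:: 2; 3]).
Let abc := h (vset [:: 0; 1; 2]).
Let abd := h (vset [:: 0; 1; 3]).

Lemma ae_le : ae <= a + e. Proof. exact: vset_subadd [:: 0] [:: 4]. Qed.
Lemma be_le : be <= b + e. Proof. exact: vset_subadd [:: 1] [:: 4]. Qed.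
Lemma cd_le : cd <= c + d. Proof. exact: vset_subadd [:: 2] [:: 3]. Qed.

Lemma core_edge_le i j : (i, j) \in core_edges -> h (vset [:: i; j]) <= 1.
Proof.
move=> ij; have /andP[i32 j32] : (i < 32)%N && (j < 32)%N.
  by move: ij; rewrite !inE => /or4P[|||/or4P[|||]] /eqP[-> ->].
by apply: edge_le1 => //; rewrite /adj mem_cat ij.
Qed.

(** A and E are the two common neighbours used: submodularity of the edges from
    [k] to C and D. *)
Lemma cd_mid k : (k == 0)%N || (k == 4)%N -> cd + h (vset [:: k]) <= 2.
Proof.
move=> k04.
have sub : h (vset [:: k; 2; 3]) + h (vset [:: k]) <= h (vset [:: k; 2]) + h (vset [:: k; 3]).
  apply: vset_submod; last by case/orP: k04 => /eqP->.
  by apply: vset_perm => x; rewrite !inE; case: (x == k); case: (x == 2)%N; case: (x == 3)%N.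
have mono : cd <= h (vset [:: k; 2; 3]).
  case: hP => _ _ /(_ (vset [:: 2; 3]) (vset [:: k])) + _.
  rewrite -vset_cat (@vset_perm ([:: 2; 3] ++ [:: k])%N [:: k; 2; 3]) // => x.
  by rewrite !inE orbA orbC.
have [k2 k3] : h (vset [:: k; 2]) <= 1 /\ h (vset [:: k; 3]) <= 1.
  case/orP: k04 => /eqP->; first by split; apply: core_edge_le.
  rewrite (@vset_perm [:: 4; 2]%N [:: 2; 4]%N); last by move=> x; rewrite !inE orbC.
  rewrite (@vset_perm [:: 4; 3]%N [:: 3; 4]%N); last by move=> x; rewrite !inE orbC.
  by split; apply: core_edge_le.
lra.
Qed.

(** h(AE) + 2 h(CD) <= (h(A) + h(CD)) + (h(E) + h(CD)) <= 4. *)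
Lemma subw_key : exists2 k, (k < 5)%N & h (vset (key k)) <= 4 / 3.
Proof.
apply: (@key_le h _ 1 0 2 0 0); rewrite ?ler0n //; try lra.
have := ae_le; have := @cd_mid 0 isT; have := @cd_mid 4 isT.
rewrite -/a -/e -/cd -/ae; lra.
Qed.

(** Equivalently, I(A;B) <= I(A;B|C) + I(A;B|D) + I(C;D).  Its greater side
    consists of the five core edges not at E, its smaller side of three keys and
    the values at A and B. *)
Definition ingleton (f : {set G32} -> R) : Prop :=
  f (vset [:: 0]) + f (vset [:: 1]) + f (vset [:: 0; 1; 2]) + f (vset [:: 0; 1; 3])
    + f (vset [:: 2; 3]) <=
  f (vset [:: 0; 1]) + f (vset [:: 0; 2]) + f (vset [:: 0; 3]) + f (vset [:: 1; 2])
    + f (vset [:: 1; 3]).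

(** Adding h(AE) <= h(A) + h(E), h(BE) <= h(B) + h(E) and twice
    h(E) + h(CD) <= h(CE) + h(DE) <= 2 to the Ingleton inequality leaves
    h(AE) + h(BE) + 3 h(CD) + h(ABC) + h(ABD) <= 9. *)
Lemma linw_key : ingleton h -> exists2 k, (k < 5)%N & h (vset (key k)) <= 9 / 7.
Proof.
rewrite /ingleton -/a -/b -/abc -/abd -/cd => ing.
apply: (@key_le h _ 1 1 3 1 1); rewrite ?ler0n //; try lra.
have := ae_le; have := be_le; have := @cd_mid 4 isT.
have := @core_edge_le 0 1 isT; have := @core_edge_le 0 2 isT.
have := @core_edge_le 0 3 isT; have := @core_edge_le 1 2 isT.
have := @core_edge_le 1 3 isT.
rewrite -/a -/b -/e -/ae -/be -/cd -/abc -/abd; lra.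
Qed.

(** Equivalently, for P and Q at the vertices [p] and [q],
    I(A;B) <= 2 I(A;B|P) + I(A;B|Q) + I(P;Q) + I(A;P|B) + I(B;P|A). *)
Definition zhang_yeung (f : {set G32} -> R) (p q : nat) : Prop :=
  2 * (f (vset [:: 0]) + f (vset [:: 1])) + f (vset [:: p]) + f (vset [:: p; q])
    + 4 * f (vset [:: 0; 1; p]) + f (vset [:: 0; 1; q]) <=
  3 * (f (vset [:: 0; 1]) + f (vset [:: 0; p]) + f (vset [:: 1; p]))
    + f (vset [:: 0; q]) + f (vset [:: 1; q]).

(** The two inequalities add up to 4 (h(A) + h(B)) + h(C) + h(D) + 2 h(CD)
    + 5 (h(ABC) + h(ABD)) <= 22 when the edges have value at most 1; the values
    at single vertices are then removed as in [linw_key]. *)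
Lemma entw_key : zhang_yeung h 2 3 -> zhang_yeung h 3 2 ->
  exists2 k, (k < 5)%N & h (vset (key k)) <= 38 / 29.
Proof.
have dc : vset [:: 3; 2]%N = vset [:: 2; 3]%N by apply: vset_perm => x; rewrite !inE orbC.
rewrite /zhang_yeung dc -/a -/b -/c -/d -/abc -/abd -/cd => zyC zyD.
apply: (@key_le h _ 4 4 11 5 5); rewrite ?ler0n //; try lra.
have := ae_le; have := be_le; have := cd_le; have := @cd_mid 4 isT.
have := @core_edge_le 0 1 isT; have := @core_edge_le 0 2 isT.
have := @core_edge_le 0 3 isT; have := @core_edge_le 1 2 isT.
have := @core_edge_le 1 3 isT.
rewrite -/a -/b -/c -/d -/e -/ae -/be -/cd -/abc -/abd; lra.
Qed.

End Polymatroid.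

Lemma step_vset K s : all (fun i => i < 32)%N s ->
  step K (vset s) = (has (fun i => vtx i \in K) s)%:R :> R.
Proof.
move=> /allP s32; rewrite stepE; congr (nat_of_bool _)%:R; apply/set0Pn/hasP.
  by case=> x; rewrite !inE => /andP[xs xK]; exists (idx x) => //; rewrite idxK.
by case=> i is_ iK; exists (vtx i); rewrite !inE vtxK ?is_ //; apply: s32.
Qed.

(** The combination 2 AE + 2 BE + 5 CD + ABC + ABD of the keys is at most the
    combination 2 (AC + AD + BC + BD) + 3 (CE + DE) of the edges, as one sees by
    checking the 32 possible traces of a step function on the core. *)
Lemma normw_key h : normal h -> edge_dominated h ->
  exists2 k, (k < 5)%N & h (vset (key k)) <= 14 / 11.
Proof.
move=> hN hE; apply: (@key_le h _ 2 2 5 1 1); rewrite ?ler0n //; try lra.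
pose l : seq (R * {set G32}) := [:: (-2, vset [:: 0; 4]%N); (-2, vset [:: 1; 4]%N);
   (-5, vset [:: 2; 3]%N); (-1, vset [:: 0; 1; 2]%N); (-1, vset [:: 0; 1; 3]%N);
   (2, vset [:: 0; 2]%N); (2, vset [:: 0; 3]%N); (2, vset [:: 1; 2]%N);
   (2, vset [:: 1; 3]%N); (3, vset [:: 2; 4]%N); (3, vset [:: 3; 4]%N)].
have : 0 <= lform l h.
  apply: normal_lform_ge0 hN => K; rewrite /lform !big_cons big_nil /= !step_vset //=.
  by case: (_ \in K); case: (_ \in K); case: (_ \in K); case: (_ \in K);
    case: (_ \in K) => /=; lra.
have E := core_edge_le hE.
have := E 0 2 isT; have := E 0 3 isT; have := E 1 2 isT; have := E 1 3 isT.
have := E 2 4 isT; have := E 3 4 isT.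
rewrite /lform !big_cons big_nil /=; lra.
Qed.

(** Modularity allows to swap ends: AE + CD = AC + DE. *)
Lemma adw_key h : modular h -> edge_dominated h ->
  exists2 k, (k < 5)%N & h (vset (key k)) <= 1.
Proof.
case=> w [w0 hW] hE; apply: (@key_le h _ 1 0 1 0 0); rewrite ?ler0n //; try lra.
have val_ s : uniq s -> all (fun i => i < 32)%N s -> h (vset s) = \sum_(i <- s) w (vtx i).
  move=> us s32; rewrite hW -(sum_vset (fun i => w (vtx i))) //.
  by apply: eq_bigr => x _; rewrite idxK.
have := core_edge_le hE (isT : (0, 2)%N \in core_edges).
have := core_edge_le hE (isT : (3, 4)%N \in core_edges).
rewrite !val_ // !big_cons !big_nil; lra.
Qed.

End KeyBounds.

(** * Values of the submodular, normal and adaptive widths *)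

Section CoreExamples.
Context {R : realType}.

(** The rank of a set among five lines in projective 3-space that pairwise meet
    exactly along the core edges and are otherwise in general position.  No
    such lines exist, since this polymatroid violates the Ingleton inequality:
    its restriction to A, B, C, D comes from the Vamos matroid. *)
Definition lines_rank (a b c d e : bool) : nat :=
  match (a + b + c + d + e)%N with
  | 0 => 0
  | 1 => 2
  | 2 => if (a && e) || (b && e) || (c && d) then 4 else 3
  | _ => 4
  end.

Lemma lines_rank_polymatroid : polymatroid
  (core_fun (fun a b c d e => (lines_rank a b c d e)%:R / 3 : R)).
Proof.
split.
- by move=> U; rewrite divr_ge0.
- by rewrite /core_fun !inE /= mul0r.
- move=> U W; rewrite ler_pM2r ?invr_gt0 // ler_nat !inE.
  by do 10! case: (_ \in _).
- move=> U W; rewrite /core_fun -!mulrDl ler_pM2r ?invr_gt0 // -!natrD ler_nat !inE.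
  by do 10! case: (_ \in _).
Qed.

End CoreExamples.

(** * Linear polymatroids *)

Section Pointwise.
Local Open Scope classical_set_scope.
Context {R : realType} {V : finType}.
Implicit Types (h g : {set V} -> R).

Lemma ptws_cvgP (F : set_system {ptws {set V} -> R}) (h : {ptws {set V} -> R}) :
  Filter F -> {ptws, F --> h} <-> forall U, (fun g : {ptws {set V} -> R} => g U) @ F --> h U.
Proof.
move=> FF; split=> [Fh U|Fh].
  exact: cvg_trans (cvg_app (proj U) Fh) (@proj_continuous _ (fun=> R) U h).
apply/cvg_sup => U; apply/cvg_image.
  by rewrite eqEsubset; split=> // x _; exists (fun=> x).
move=> W /= /(Fh U) FW; exists ((fun g : {ptws {set V} -> R} => g U) @^-1` W) => //.
by rewrite eqEsubset; split=> [x [g Wg <-]|x Wx] //; exists (fun=> x).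
Qed.

Lemma approx_of_cvg (C : ({set V} -> R) -> Prop) (u : nat -> {set V} -> R) h :
  (forall n, C (u n)) -> {ptws, u @ \oo --> h} -> approximable C h.
Proof.
move=> Cu /ptws_cvgP uh e e0.
have H : \forall n \near \oo, forall U, `|h U - u n U| < e.
  apply: filter_forall => U; have /cvgrPdist_lt/(_ e e0) := uh U.
  exact.
have [n _ Hn] := H; exists (u n) => // U; exact: (Hn n (leqnn n)).
Qed.

Lemma closure_approx (E : set ({set V} -> R)) h :
  closure (E : set {ptws {set V} -> R}) h <-> approximable E h.
Proof.
split.
  move=> cl e e0.
  have nb : \forall g \near (h : {ptws {set V} -> R}), forall U, `|h U - g U| < e.
    have /ptws_cvgP hh : {ptws, nbhs (h : {ptws {set V} -> R}) --> h} by apply: cvg_id.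
    apply: (@filter_forall _ {set V} (fun U (g : {ptws {set V} -> R}) => `|h U - g U| < e)
      _ (nbhs_filter _)) => U.
    have /cvgrPdist_lt/(_ e e0) := hh U; exact.
  by have [g [Eg gh]] := cl _ nb; exists g.
move=> ap B nB.
have pos n : 0 < n.+1%:R^-1 :> R by rewrite invr_gt0.
pose u n := projT1 (boolp.cid2 (ap _ (pos n))).
have uE n : E (u n) by rewrite /u; case: boolp.cid2.
have uh n U : `|h U - u n U| < n.+1%:R^-1 by rewrite /u; case: boolp.cid2.
have : {ptws, u @ \oo --> h}.
  apply/ptws_cvgP => U; apply/cvgrPdist_lt => e e0.
  suff : \forall n \near \oo, `|h U - u n U| < e by [].
  near=> n; apply: (lt_trans (uh n U)).
  by near: n; apply: near_infty_natSinv_lt (PosNum e0).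
move/(_ _ nB) => [n _ Hn].
by exists (u n); split=> //; apply: (Hn n (leqnn n)).
Unshelve. all: by end_near. Qed.

End Pointwise.

Section RankFunctions.
Context {R : realType} {V : finType}.

Lemma rank_functionE d (phi : V -> seq 'rV[R]_d) (U : {set V}) :
  (<<flatten [seq phi v | v <- enum U]>> = \sum_(v in U) <<phi v>>)%VS.
Proof.
rewrite -big_enum /=; elim: (enum U) => [|v s IHs] /=.
  by rewrite big_nil span_nil.
by rewrite big_cons span_cat IHs.
Qed.

Lemma rank_functionP (r : {set V} -> R) : rank_function r <->
  exists (d : nat) (W : V -> {vspace 'rV[R]_d}),
    forall U, r U = (\dim (\sum_(v in U) W v)%VS)%:R.
Proof.
split=> -[d [W rW]].
  by exists d, (fun v => <<W v>>%VS) => U; rewrite rW rank_functionE.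
exists d, (fun v => vbasis (W v) : seq _) => U; rewrite rW rank_functionE.
congr (\dim _)%:R; apply: eq_bigr => v _.
by rewrite (span_basis (vbasisP _)).
Qed.

Section Space.
Variables (d : nat) (W : V -> {vspace 'rV[R]_d}).
Definition space_of (U : {set V}) := (\sum_(v in U) W v)%VS.

Lemma space_ofP v (U : {set V}) : v \in U -> (W v <= space_of U)%VS.
Proof. by move=> vU; apply: (sumv_sup v). Qed.

Lemma space_ofS (U U' : {set V}) : U \subset U' -> (space_of U <= space_of U')%VS.
Proof.
by move=> /fintype.subsetP UU; apply/subv_sumP => v /UU; apply: space_ofP.
Qed.

Lemma space_ofU (U U' : {set V}) : space_of (U :|: U')%SET = (space_of U + space_of U')%VS.
Proof.
apply/eqP; rewrite eqEsubv subv_add !space_ofS ?finset.subsetUl ?finset.subsetUr //.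
rewrite !andbT; apply/subv_sumP => v; rewrite inE => /orP[] vU.
  by apply: subv_trans (space_ofP vU) (addvSl _ _).
by apply: subv_trans (space_ofP vU) (addvSr _ _).
Qed.

Lemma space_of0 : space_of finset.set0 = 0%VS.
Proof. by rewrite /space_of big_set0. Qed.

End Space.

Lemma dim_submod d (X Y : {vspace 'rV[R]_d}) Z : (Z <= X :&: Y)%VS ->
  (\dim (X + Y) + \dim Z <= \dim X + \dim Y)%N.
Proof. by move=> ZXY; rewrite -(dimv_sum_cap X Y) leq_add2l dimvS. Qed.

(** The intersection of two subspaces carries their mutual information, which
    no argument from submodularity alone can provide. *)
Lemma dim_ingleton d (A B C D : {vspace 'rV[R]_d}) :
  (\dim A + \dim B + \dim (A + B + C) + \dim (A + B + D) + \dim (C + D) <=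
   \dim (A + B) + \dim (A + C) + \dim (A + D) + \dim (B + C) + \dim (B + D))%N.
Proof.
have capE := dimv_sum_cap A B.
have side X : (\dim (A + B + X) + \dim (A :&: B + X) <= \dim (A + X) + \dim (B + X))%N.
  have -> : (A + B + X = (A + X) + (B + X))%VS.
    by rewrite -[RHS]addvA (addvC X (B + X)%VS) -(addvA B) addvv addvA.
  by apply: dim_submod; rewrite subv_cap !addvS // ?capvSl ?capvSr.
have := side C; have := side D.
have : (\dim (C + D) + \dim (A :&: B) <= \dim (A :&: B + C) + \dim (A :&: B + D))%N.
  apply: leq_trans (dim_submod (_ : A :&: B <= _)%VS); last first.
    by rewrite subv_cap !addvSl.
  rewrite leq_add2r dimvS // subv_add.
  by rewrite (subv_trans (addvSr (A :&: B) C)) ?addvSl // (subv_trans (addvSr (A :&: B) D)) ?addvSr.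
lia.
Qed.

Lemma rank_function_polymatroid (r : {set V} -> R) : rank_function r -> polymatroid r.
Proof.
case/rank_functionP=> d [W rW]; split.
- by move=> U; rewrite rW.
- by rewrite rW -/(space_of W _) space_of0 dimv0.
- by move=> U U'; rewrite !rW ler_nat dimvS // space_ofS // finset.subsetUl.
- move=> U U'; rewrite !rW -!natrD ler_nat -!/(space_of W _) space_ofU.
  apply: dim_submod; rewrite subv_cap.
  by rewrite !space_ofS ?finset.subsetIl ?finset.subsetIr.
Qed.

Section DirectSum.
Variables (d1 d2 : nat).
Let inl_ := linfun (mulmxr (row_mx 1%:M 0 : 'M[R]_(d1, d1 + d2))) : 'Hom('rV_d1, 'rV_(d1 + d2)).
Let inr_ := linfun (mulmxr (row_mx 0 1%:M : 'M[R]_(d2, d1 + d2))) : 'Hom('rV_d2, 'rV_(d1 + d2)).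

Let inlE u : inl_ u = row_mx u 0.
Proof. by rewrite lfunE /= mul_mx_row mulmx1 mulmx0. Qed.
Let inrE u : inr_ u = row_mx 0 u.
Proof. by rewrite lfunE /= mul_mx_row mulmx1 mulmx0. Qed.

Lemma dim_direct_sum (X : {vspace 'rV[R]_d1}) (Y : {vspace 'rV[R]_d2}) :
  \dim (inl_ @: X + inr_ @: Y)%VS = (\dim X + \dim Y)%N.
Proof.
have kl : (X :&: lker inl_ = 0)%VS.
  apply/eqP; rewrite -subv0; apply/subvP => u; rewrite memv_cap memv_ker inlE.
  case/andP=> _ /eqP; rewrite -[0 in RHS]row_mx0 => /eq_row_mx[-> _].
  exact: mem0v.
have kr : (Y :&: lker inr_ = 0)%VS.
  apply/eqP; rewrite -subv0; apply/subvP => u; rewrite memv_cap memv_ker inrE.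
  case/andP=> _ /eqP; rewrite -[0 in RHS]row_mx0 => /eq_row_mx[_ ->].
  exact: mem0v.
rewrite dimv_disjoint_sum ?(limg_dim_eq kl) ?(limg_dim_eq kr) //.
apply/eqP; rewrite -subv0; apply/subvP => u; rewrite memv_cap.
case/andP=> /memv_imgP[x _ ->] /memv_imgP[y _]; rewrite inlE inrE.
by case/eq_row_mx => -> _; rewrite row_mx0 mem0v.
Qed.

Lemma space_direct_sum (W1 : V -> {vspace 'rV[R]_d1}) (W2 : V -> {vspace 'rV[R]_d2}) (U : {set V}) :
  \dim (\sum_(v in U) (inl_ @: W1 v + inr_ @: W2 v))%VS =
  (\dim (\sum_(v in U) W1 v) + \dim (\sum_(v in U) W2 v))%N.
Proof. by rewrite big_split /= -!limg_sum dim_direct_sum. Qed.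

End DirectSum.

Lemma rank_functionD (r1 r2 : {set V} -> R) :
  rank_function r1 -> rank_function r2 -> rank_function (fun U => r1 U + r2 U).
Proof.
case/rank_functionP=> d1 [W1 rW1] /rank_functionP[d2 [W2 rW2]].
apply/rank_functionP; eexists _, _ => U.
by rewrite rW1 rW2 -natrD -space_direct_sum.
Qed.

Lemma rank_function0 : rank_function (fun _ : {set V} => 0 : R).
Proof.
apply/rank_functionP; exists 0%N, (fun=> 0%VS) => U.
by rewrite big1 // dimv0.
Qed.

Lemma rank_function_step (K : {set V}) : rank_function (step K : {set V} -> R).
Proof.
apply/rank_functionP; exists 1%N, (fun v => if v \in K then fullv else 0%VS) => U.
rewrite /step; case: ifP => [/set0Pn[v]|/negbFE/eqP UK].
  rewrite inE => /andP[vU vK]; rewrite -/(space_of _ U); set S := space_of _ U.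
  suff -> : S = fullv by rewrite dimvf dim_matrix.
  apply/eqP; rewrite eqEsubv subvf; apply: (sumv_sup v) => //.
  by rewrite vK subvv.
rewrite big1 ?dimv0 // => v vU; case: ifP => // vK.
by have : v \in U :&: K by [rewrite inE vU vK]; rewrite UK inE.
Qed.

Lemma scaled_rank_linear (c : R) (r : {set V} -> R) : 0 <= c -> rank_function r ->
  linear_polymatroid (fun U => c * r U).
Proof.
move=> c0 rR; exists (fun _ U => c * r U); split; first by move=> _; exists c, r.
by apply/ptws_cvgP => U; apply: cvg_cst.
Qed.

Lemma linear_approx (h : {set V} -> R) : linear_polymatroid h ->
  approximable (fun g => exists c r, [/\ 0 <= c, rank_function r & forall U, g U = c * r U]) h.
Proof. by case=> u [uP /approx_of_cvg]; apply. Qed.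

End RankFunctions.

Lemma rank_function_ingleton (R : realType) (r : {set G32} -> R) :
  rank_function r -> ingleton r.
Proof.
case/rank_functionP=> d [W rW]; rewrite /ingleton !rW -!natrD ler_nat.
rewrite -!/(space_of W _).
have E2 i j : space_of W (vset [:: i; j]) = (space_of W (vset [:: i]) + space_of W (vset [:: j]))%VS.
  by rewrite -space_ofU -vset_cat.
have E3 i j k : space_of W (vset [:: i; j; k]) =
   (space_of W (vset [:: i]) + space_of W (vset [:: j]) + space_of W (vset [:: k]))%VS.
  by rewrite -!space_ofU -!vset_cat.
by rewrite !E2 !E3 dim_ingleton.
Qed.

Lemma linear_ingleton (R : realType) (h : {set G32} -> R) :
  linear_polymatroid h -> ingleton h.
Proof.
move=> /linear_approx hA.
have := @approx_lform_ge0 R _ _ [:: (-1, vset [:: 0%N]); (-1, vset [:: 1%N]);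
  (-1, vset [:: 0; 1; 2]%N); (-1, vset [:: 0; 1; 3]%N); (-1, vset [:: 2; 3]%N);
  (1, vset [:: 0; 1]%N); (1, vset [:: 0; 2]%N); (1, vset [:: 0; 3]%N);
  (1, vset [:: 1; 2]%N); (1, vset [:: 1; 3]%N)] h hA.
rewrite /lform !big_cons big_nil /ingleton /= => H.
have {}H : 0 <= h (vset [:: 0; 1]%N) + h (vset [:: 0; 2]%N) + h (vset [:: 0; 3]%N)
    + h (vset [:: 1; 2]%N) + h (vset [:: 1; 3]%N) - (h (vset [:: 0%N]) + h (vset [:: 1%N])
    + h (vset [:: 0; 1; 2]%N) + h (vset [:: 0; 1; 3]%N) + h (vset [:: 2; 3]%N)).
  apply: le_trans (H _) _; last by lra.
  move=> g [c [r [c0 /rank_function_ingleton ing gE]]]; rewrite !big_cons big_nil !gE /=.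
  have := ler_wpM2l c0 ing; rewrite !mulrDr; lra.
lra.
Qed.

Lemma linear_is_polymatroid (R : realType) (V : finType) (h : {set V} -> R) :
  linear_polymatroid h -> polymatroid h.
Proof.
move=> /linear_approx/polymatroid_approx; apply => g [c [r [c0 rR /boolp.funext->]]].
have := @polymatroid_sum R V unit [:: tt] (fun=> c) (fun=> r) (fun=> c0) (fun=> rank_function_polymatroid rR).
by under boolp.eq_fun do rewrite big_seq1.
Qed.

(** Two generic vectors at A and B, their sum at E, and both of them at [k].
    The same function is the entropy of two fair bits with their exclusive or. *)
Definition xor_rank (k : nat) (U : {set G32}) : nat :=
  if vtx k \in U then 2 else minn 2 ((vtx 0 \in U) + (vtx 1 \in U) + (vtx 4 \in U)).

Section XorRank.
Context {R : realType}.

Let e0 : 'rV[R]_2 := delta_mx 0 0.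
Let e1 : 'rV[R]_2 := delta_mx 0 1.

Lemma xor_rank_function k : (k == 2)%N || (k == 3)%N ->
  rank_function (fun U => (xor_rank k U)%:R : R).
Proof.
move=> k23; pose line (v : G32) : {vspace 'rV[R]_2} :=
  if v == vtx k then fullv else if v == vtx 0 then <[e0]>%VS
  else if v == vtx 1 then <[e1]>%VS else if v == vtx 4 then <[e0 + e1]>%VS else 0%VS.
apply/rank_functionP; exists 2%N, line => U; congr (_ %:R).
rewrite -/(space_of line U); set S := space_of line U.
have vtx_eq i j : (i < 32)%N -> (j < 32)%N -> (vtx i == vtx j) = (i == j).
  by move=> i32 j32; rewrite -(inj_eq idx_inj) !vtxK.
have k32 : (k < 32)%N by case/orP: k23 => /eqP->.
have [nk0 nk1 nk4] : [/\ (0 == k)%N = false, (1 == k)%N = false & (4 == k)%N = false].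
  by case/orP: k23 => /eqP->.
have lk : line (vtx k) = fullv by rewrite /line eqxx.
have l0 : line (vtx 0) = <[e0]>%VS by rewrite /line !vtx_eq // nk0.
have l1 : line (vtx 1) = <[e1]>%VS by rewrite /line !vtx_eq // nk1.
have l4 : line (vtx 4) = <[e0 + e1]>%VS by rewrite /line !vtx_eq // nk4.
have mem_line v x : v \in U -> x \in line v -> x \in S.
  by move=> vU; apply/subvP/space_ofP.
have full : e0 \in S -> e1 \in S -> \dim S = 2%N.
  move=> S0 S1; suff -> : S = fullv by rewrite dimvf dim_matrix.
  apply/eqP; rewrite eqEsubv subvf; apply/subvP => x _.
  have -> : x = x 0 0 *: e0 + x 0 1 *: e1.
    apply/rowP => j; rewrite !mxE /= ; case: j => -[|[|//]] j2.
      by rewrite (_ : Ordinal j2 = 0) ?eqxx /=; [ring | apply: val_inj].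
    by rewrite (_ : Ordinal j2 = 1) ?eqxx /=; [ring | apply: val_inj].
  by rewrite memvD // memvZ.
have only (L : {vspace 'rV[R]_2}) : (forall v, v \in U -> (line v <= L)%VS) ->
    (S <= L)%VS by move=> H; apply/subv_sumP.
have lineP v : v \in U -> vtx k \notin U -> 
    [\/ vtx 0 \in U /\ line v = <[e0]>%VS, vtx 1 \in U /\ line v = <[e1]>%VS,
        vtx 4 \in U /\ line v = <[e0 + e1]>%VS | line v = 0%VS].
  move=> vU kU; rewrite /line; case: eqP => [vk|_]; first by rewrite vk (negbTE kU) in vU.
  case: eqP => [<-|_]; first by constructor 1.
  case: eqP => [<-|_]; first by constructor 2.
  by case: eqP => [<-|_]; [constructor 3 | constructor 4].
have e0n : e0 != 0.
  by apply/eqP => /rowP/(_ 0); rewrite !mxE /= => /eqP; rewrite oner_eq0.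
have e1n : e1 != 0.
  by apply/eqP => /rowP/(_ 1); rewrite !mxE /= => /eqP; rewrite oner_eq0.
have e01n : e0 + e1 != 0.
  by apply/eqP => /rowP/(_ 0); rewrite !mxE /= addr0 => /eqP; rewrite oner_eq0.
have one i x : vtx i \in U -> line (vtx i) = <[x]>%VS -> x != 0 -> (S <= <[x]>)%VS ->
    \dim S = 1%N.
  move=> iU lx xn Sx; suff -> : S = <[x]>%VS by rewrite dim_vline xn.
  by apply/eqP; rewrite eqEsubv Sx -lx space_ofP.
rewrite /xor_rank; case: ifPn => [kU|kU].
  by rewrite full //; apply: (mem_line _ _ kU); rewrite lk memvf.
have [U0|U0] := boolP (vtx 0 \in U); have [U1|U1] := boolP (vtx 1 \in U);
  have [U4|U4] := boolP (vtx 4 \in U) => /=.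
- by rewrite full //; [apply: (mem_line _ _ U0)|apply: (mem_line _ _ U1)];
    rewrite ?l0 ?l1 memv_line.
- by rewrite full //; [apply: (mem_line _ _ U0)|apply: (mem_line _ _ U1)];
    rewrite ?l0 ?l1 memv_line.
- have S0 : e0 \in S by apply: (mem_line _ _ U0); rewrite l0 memv_line.
  rewrite full // -[e1](addKr e0) memvD ?memvN //.
  by apply: (mem_line _ _ U4); rewrite l4 memv_line.
- rewrite (one _ _ U0 l0) //; apply: only => v vU.
  by case: (lineP v vU kU) => [[_ ->]|[]|[]|->]; rewrite ?(negbTE U1) ?(negbTE U4) ?subv0 ?sub0v.
- have S1 : e1 \in S by apply: (mem_line _ _ U1); rewrite l1 memv_line.
  rewrite full // -[e0](addrK e1) memvB //.
  by apply: (mem_line _ _ U4); rewrite l4 memv_line.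
- rewrite (one _ _ U1 l1) //; apply: only => v vU.
  by case: (lineP v vU kU) => [[]|[_ ->]|[]|->]; rewrite ?(negbTE U0) ?(negbTE U4) ?subv0 ?sub0v.
- rewrite (one _ _ U4 l4) //; apply: only => v vU.
  by case: (lineP v vU kU) => [[]|[]|[_ ->]|->]; rewrite ?(negbTE U0) ?(negbTE U1) ?subv0 ?sub0v.
- suff -> : S = 0%VS by rewrite dimv0.
  apply/eqP; rewrite -subv0; apply: only => v vU.
  by case: (lineP v vU kU) => [[]|[]|[]|->]; rewrite ?(negbTE U0) ?(negbTE U1) ?(negbTE U4) ?subv0.
Qed.

End XorRank.

(** * Entropy of equivalence relations on a finite probability space *)

Definition equiv (T : Type) (r : rel T) := [/\ reflexive r, symmetric r & transitive r].

Definition meet_rel (T : Type) (r s : rel T) : rel T := fun x y => r x y && s x y.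
Definition pull_rel (T T' : Type) (f : T' -> T) (r : rel T) : rel T' := fun x y => r (f x) (f y).

Lemma equiv_meet (T : Type) (r s : rel T) : equiv r -> equiv s -> equiv (meet_rel r s).
Proof.
case=> r1 r2 r3 [s1 s2 s3]; split.
- by move=> x; rewrite /meet_rel r1 s1.
- by move=> x y; rewrite /meet_rel r2 s2.
- move=> y x z /andP[a b] /andP[c d]; apply/andP.
  by split; [apply: r3 a c | apply: s3 b d].
Qed.

Lemma equiv_pull (T T' : Type) (f : T' -> T) (r : rel T) : equiv r -> equiv (pull_rel f r).
Proof.
case=> r1 r2 r3; split; first by move=> x; apply: r1.
- by move=> x y; apply: r2.
- by move=> y x z; apply: r3.
Qed.

Lemma equiv_class (T : Type) (r : rel T) x y : equiv r -> r x y -> r x =1 r y.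
Proof.
case=> _ rs rt xy z; apply/idP/idP => H; last exact: rt H.
by apply: rt H; rewrite rs.
Qed.

Definition finite_pmf (R : realType) (T : finType) (p : T -> R) :=
  (forall x, 0 <= p x) /\ \sum_x p x = 1.

Section Entropy.
Context {R : realType} {T : finType}.
Variable p : T -> R.
Hypothesis p_pmf : finite_pmf p.
Implicit Types r s : rel T.

Let p0 x : 0 <= p x. Proof. by case: p_pmf. Qed.
Let p1 : \sum_x p x = 1. Proof. by case: p_pmf. Qed.

Definition mass (r : rel T) (x : T) : R := \sum_(y | r x y) p y.

(** The entropy, in nats, of the class of a random point.  A random variable is
    represented by the relation of having the same value. *)
Definition ent (r : rel T) : R := - \sum_x p x * ln (mass r x).

Lemma mass_ge0 r x : 0 <= mass r x. Proof. exact: sumr_ge0. Qed.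

Lemma mass_le1 r x : mass r x <= 1.
Proof.
rewrite -p1 /mass big_mkcond; apply: ler_sum => y _; by case: ifP.
Qed.

Lemma le_mass r x : r x x -> p x <= mass r x.
Proof. by move=> rx; rewrite /mass (bigD1 x) //= lerDl sumr_ge0. Qed.

Lemma mass_gt0 r x : r x x -> 0 < p x -> 0 < mass r x.
Proof. by move=> rx px; apply: lt_le_trans px (le_mass rx). Qed.

Lemma massS r s x : (forall y, r x y -> s x y) -> mass r x <= mass s x.
Proof.
move=> rs; rewrite /mass [leLHS]big_mkcond [leRHS]big_mkcond /=.
by apply: ler_sum => y _; case: ifP => [/rs->//|_]; case: ifP.
Qed.

Lemma eq_mass r s x : r x =1 s x -> mass r x = mass s x.
Proof. by move=> rs; apply: eq_bigl. Qed.

Lemma eq_ent r s : (forall x y, 0 < p x -> 0 < p y -> r x y = s x y) -> ent r = ent s.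
Proof.
move=> rs; congr (- _); apply: eq_bigr => x _.
have [px|] := ltP 0 (p x); last first.
  by move=> px; rewrite (_ : p x = 0) ?mul0r //; apply/eqP; rewrite eq_le px p0.
congr (_ * ln _); rewrite /mass [LHS]big_mkcond [RHS]big_mkcond /=.
apply: eq_bigr => y _; have [py|py] := ltP 0 (p y); first by rewrite rs.
have -> : p y = 0 by apply/eqP; rewrite eq_le py p0.
by case: ifP; case: ifP.
Qed.

Lemma ent_ge0 r : 0 <= ent r.
Proof.
rewrite oppr_ge0 -oppr_ge0 -sumrN sumr_ge0 // => x _.
by rewrite -mulrN mulr_ge0 // oppr_ge0 ln_le0 // mass_le1.
Qed.

Lemma le_ent r s : reflexive r -> (forall x y, r x y -> s x y) -> ent s <= ent r.
Proof.
move=> rr rs; rewrite lerN2; apply: ler_sum => x _.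
have [px|] := ltP 0 (p x); last first.
  by move=> px; rewrite (_ : p x = 0) ?mul0r //; apply/eqP; rewrite eq_le px p0.
rewrite ler_wpM2l // ler_ln ?posrE ?mass_gt0 // ?rs //.
by apply: massS => y; apply: rs.
Qed.

Lemma ent_trivial r : (forall x y, r x y) -> ent r = 0.
Proof.
move=> rT; rewrite /ent big1 ?oppr0 // => x _.
by rewrite /mass (eq_bigl predT) ?p1 ?ln1 ?mulr0 // => y; rewrite rT.
Qed.

(** Submodularity in terms of the join [j] and a common coarsening [m] of [f]
    and [g]: by [ln x >= 1 - 1/x] the defect is at least one minus a total mass,
    and summing first over the points of the [j]-classes shows that this total
    mass is at most one. *)
Lemma ent_submod (f g j m : rel T) : equiv f -> equiv g -> equiv m ->
  (forall x y, j x y = f x y && g x y) ->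
  (forall x y, f x y -> m x y) -> (forall x y, g x y -> m x y) ->
  ent j + ent m <= ent f + ent g.
Proof.
move=> fE gE mE jE fm gm.
have [fr fs ft] := fE; have [gr gs gt] := gE; have [mr ms mt] := mE.
have jr x : j x x by rewrite jE fr gr.
pose Q x := mass f x * mass g x / (mass j x * mass m x).
have total : \sum_x p x * Q x <= 1.
  have E x : p x * Q x = \sum_y \sum_z
      (if f x y && g x z then p y * p z * (p x / (mass j x * mass m x)) else 0).
    rewrite /Q mulrCA; set K := p x / _.
    rewrite /mass big_distrlr big_distrl [LHS]big_mkcond /=.
    apply: eq_bigr => y _; case: (f x y) => /=; last by rewrite big1.
    rewrite big_distrl [LHS]big_mkcond /=.
    by apply: eq_bigr => z _; case: (g x z).
  under eq_bigr do rewrite E.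
  rewrite exchange_big /=; under eq_bigr do rewrite exchange_big /=.
  rewrite -p1; apply: ler_sum => y _.
  apply: (@le_trans _ _ (\sum_(z | m y z) p y * p z / mass m y)); last first.
    rewrite -big_distrl -big_distrr /= -/(mass m y) -mulrA.
    have [->|my] := eqVneq (mass m y) 0; first by rewrite mul0r mulr0.
    by rewrite divff // mulr1.
  rewrite [leRHS]big_mkcond /=; apply: ler_sum => z _.
  rewrite -big_mkcond /=.
  have [[w /andP[wy wz]]|none] := pselect (exists w, f w y && g w z); last first.
    rewrite big_pred0; last by move=> w; apply/negbTE/negP => wP; apply: none; exists w.
    by case: ifP => // _; rewrite mulr_ge0 ?invr_ge0 ?mass_ge0 ?mulr_ge0.
  have myz : m y z by apply: (mt w); [rewrite ms fm | exact: gm].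
  have wm : mass m w = mass m y by apply: eq_mass; apply: equiv_class (fm _ _ wy).
  rewrite myz -big_distrr /= ler_wpM2l ?mulr_ge0 //.
  have jw x : f x y && g x z -> mass j x = mass j w /\ mass m x = mass m y.
    case/andP=> xy xz; have fxw : f x w by apply: ft xy _; rewrite fs.
    have gxw : g x w by apply: gt xz _; rewrite gs.
    split; last by rewrite -wm; apply: eq_mass; apply: equiv_class (fm _ _ fxw).
    by apply: eq_mass => u; rewrite !jE (equiv_class fE fxw) (equiv_class gE gxw).
  rewrite (eq_bigr (fun x => p x / mass j w / mass m y)); last first.
    by move=> x /jw[-> ->]; rewrite invfM mulrA.
  rewrite -!big_distrl /= ler_piMl ?invr_ge0 ?mass_ge0 //.
  suff -> : \sum_(x | f x y && g x z) p x = mass j w.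
    have [->|jn] := eqVneq (mass j w) 0; first by rewrite mul0r.
    by rewrite divff.
  apply: eq_bigl => x; rewrite jE (equiv_class fE wy) (equiv_class gE wz).
  by rewrite [f y x]fs [g z x]gs.
rewrite -subr_ge0 /ent.
have -> : - (\sum_x p x * ln (mass f x)) - \sum_x p x * ln (mass g x) -
    (- (\sum_x p x * ln (mass j x)) - \sum_x p x * ln (mass m x)) =
    \sum_x p x * (ln (mass j x) + ln (mass m x) - ln (mass f x) - ln (mass g x)).
  rewrite -!sumrN -!big_split -sumrN -big_split /=; apply: eq_bigr => x _; ring.
apply: (@le_trans _ _ (\sum_x p x * (1 - Q x))).
  by under eq_bigr do rewrite mulrBr mulr1; rewrite sumrB p1 subr_ge0.
apply: ler_sum => x _; have [px|] := ltP 0 (p x); last first.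
  by move=> px; rewrite (_ : p x = 0) ?mul0r //; apply/eqP; rewrite eq_le px p0.
rewrite ler_wpM2l // /Q.
have := mass_gt0 (fr x) px; have := mass_gt0 (gr x) px.
have := mass_gt0 (jr x) px; have := mass_gt0 (mr x) px.
move: (mass f x) (mass g x) (mass j x) (mass m x) => a b c d d0 c0 b0 a0.
have q0 : 0 < a * b / (c * d) by rewrite divr_gt0 // mulr_gt0.
have := @le_ln1Dx R (a * b / (c * d) - 1).
rewrite addrCA subrr addr0 ltrBrDl subrr => /(_ q0).
rewrite ln_div ?posrE ?mulr_gt0 // !lnM ?posrE //; lra.
Qed.

End Entropy.

(** * The Zhang-Yeung inequality *)

Section Copy.
Context {R : realType} {T : finType}.
Variables (p : T -> R) (r : rel T).
Hypotheses (p_pmf : finite_pmf p) (r_equiv : equiv r).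

Let p0 x : 0 <= p x. Proof. by case: p_pmf. Qed.
Let p1 : \sum_x p x = 1. Proof. by case: p_pmf. Qed.

(** Two points drawn from the same [r]-class, conditionally independently. *)
Definition copy_pmf (z : T * T) : R :=
  if r z.1 z.2 then p z.1 * p z.2 / mass p r z.1 else 0.

Lemma mass_class x y : r x y -> mass p r x = mass p r y.
Proof.
by move=> xy; apply: eq_mass; apply: equiv_class xy.
Qed.

Lemma copy_pmf_swap x y : copy_pmf (x, y) = copy_pmf (y, x).
Proof.
case: r_equiv => _ rs _; rewrite /copy_pmf /= rs; case: ifP => // xy.
by rewrite (mass_class xy) (mulrC (p x)).
Qed.

Lemma copy_marginal x : \sum_y copy_pmf (x, y) = p x.
Proof.
rewrite /copy_pmf /= -big_mkcond /= -big_distrl -big_distrr /= -/(mass p r x) -mulrA.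
have [->|px] := eqVneq (p x) 0; first by rewrite mul0r.
rewrite divff ?mulr1 //; apply: lt0r_neq0; apply: mass_gt0 => //.
  by case: r_equiv.
by rewrite lt_neqAle eq_sym px p0.
Qed.

Lemma copy_pmfP : finite_pmf copy_pmf.
Proof.
split.
  move=> z; rewrite /copy_pmf; case: ifP => // _.
  by rewrite divr_ge0 ?mulr_ge0 ?mass_ge0.
rewrite -p1 (eq_bigr (fun z => copy_pmf (z.1, z.2))); last by case.
rewrite -(pair_bigA _ (fun x y => copy_pmf (x, y))) /=.
by apply: eq_bigr => x _; rewrite copy_marginal.
Qed.

Lemma sum_fst (F : T -> R) (P : pred T) :
  \sum_(z | P z.1) copy_pmf z * F z.1 = \sum_(x | P x) p x * F x.
Proof.
rewrite (eq_bigr (fun z => copy_pmf (z.1, z.2) * F z.1)); last by case.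
rewrite (eq_bigl (fun z : T * T => P z.1 && true)); last by move=> z; rewrite andbT.
rewrite -(pair_big P xpredT (fun x y => copy_pmf (x, y) * F x)) /=.
by apply: eq_bigr => x _; rewrite -big_distrl copy_marginal.
Qed.

Lemma sum_snd (F : T -> R) (P : pred T) :
  \sum_(z | P z.2) copy_pmf z * F z.2 = \sum_(x | P x) p x * F x.
Proof.
have swapK : involutive (fun z : T * T => (z.2, z.1)) by case.
rewrite -sum_fst (reindex_inj (inv_inj swapK)) /=.
by apply: eq_bigr => -[x y] _ /=; rewrite copy_pmf_swap.
Qed.

Lemma mass_fst s z : mass copy_pmf (pull_rel fst s) z = mass p s z.1.
Proof.
have := sum_fst (fun=> 1) (s z.1); rewrite /mass.
by under eq_bigr do rewrite mulr1; under [RHS]eq_bigr do rewrite mulr1.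
Qed.

Lemma mass_snd s z : mass copy_pmf (pull_rel snd s) z = mass p s z.2.
Proof.
have := sum_snd (fun=> 1) (s z.2); rewrite /mass.
by under eq_bigr do rewrite mulr1; under [RHS]eq_bigr do rewrite mulr1.
Qed.

Lemma ent_fst s : ent copy_pmf (pull_rel fst s) = ent p s.
Proof.
rewrite /ent; congr (- _); rewrite -(sum_fst (fun x => ln (mass p s x)) xpredT).
by apply: eq_bigr => z _; rewrite mass_fst.
Qed.

Lemma ent_snd s : ent copy_pmf (pull_rel snd s) = ent p s.
Proof.
rewrite /ent; congr (- _); rewrite -(sum_snd (fun x => ln (mass p s x)) xpredT).
by apply: eq_bigr => z _; rewrite mass_snd.
Qed.

(** Given their common [r]-class, the two points are independent. *)
Lemma ent_copy s t : equiv s -> (forall x y, s x y -> r x y) -> equiv t ->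
  ent copy_pmf (meet_rel (pull_rel fst s) (pull_rel snd t)) =
  ent p s + ent p (meet_rel r t) - ent p r.
Proof.
move=> [sr ss st] sub [tr ts tt]; have [rr rs rt] := r_equiv.
rewrite -(ent_fst s) -(ent_snd (meet_rel r t)) -(ent_fst r) /ent.
apply: oppr_inj; rewrite opprK !opprD !opprK.
rewrite -big_split -sumrB /=; apply: eq_bigr => -[x y] _.
rewrite !mass_fst mass_snd /=.
have [xy|nxy] := boolP (r x y); last by rewrite /copy_pmf /= (negbTE nxy) !mul0r addr0 subrr.
have [q0|q0] := eqVneq (copy_pmf (x, y)) 0; first by rewrite q0 !mul0r addr0 subrr.
have px : 0 < p x.
  rewrite lt_neqAle p0 andbT eq_sym; apply: contra_neq q0 => px.
  by rewrite /copy_pmf /= px !mul0r if_same.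
have py : 0 < p y.
  rewrite lt_neqAle p0 andbT eq_sym; apply: contra_neq q0 => py.
  by rewrite /copy_pmf /= py mulr0 mul0r if_same.
suff -> : mass copy_pmf (meet_rel (pull_rel fst s) (pull_rel snd t)) (x, y) =
    mass p s x * mass p (meet_rel r t) y / mass p r x.
  have m1 : 0 < mass p s x by rewrite mass_gt0.
  have m2 : 0 < mass p (meet_rel r t) y by rewrite mass_gt0 // /meet_rel rr tr.
  have m3 : 0 < mass p r x by rewrite mass_gt0.
  by rewrite ln_div ?posrE ?mulr_gt0 // lnM ?posrE // !mulrDr mulrN.
rewrite {1}/mass /meet_rel /pull_rel /=.
rewrite (eq_bigr (fun z => copy_pmf (z.1, z.2))); last by case.
rewrite -(pair_big (s x) (t y) (fun a b => copy_pmf (a, b))) /=.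
rewrite {1}/mass !big_distrl /=; apply: eq_bigr => a sxa.
have ra : r a x by rewrite rs sub.
rewrite /copy_pmf /= -big_mkcondr /= (mass_class ra) -big_distrl -big_distrr /=.
congr (_ * _ / _); rewrite /mass; apply: eq_bigl => b.
rewrite andbC /meet_rel; congr andb; apply/idP/idP => H.
  by apply: (rt x); [rewrite rs|apply: (rt a); rewrite // rs].
by apply: (rt x) => //; apply: (rt y).
Qed.

End Copy.

Section ZhangYeung.
Context {R : realType} {T : finType}.
Variables (p : T -> R) (a b c d : rel T).
Hypotheses (p_pmf : finite_pmf p) (a_equiv : equiv a) (b_equiv : equiv b)
  (c_equiv : equiv c) (d_equiv : equiv d).

Let ab := meet_rel a b.

(** Entropies on the space of the copy [w] of [c] over [a, b], indexed by the
    lists of the relations that are met: 0 to 3 for [a] to [d], 4 for [w]. *)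
Let q := copy_pmf p ab.
Let X (i : nat) : rel (T * T) :=
  nth (pull_rel snd c) [:: pull_rel fst a; pull_rel fst b; pull_rel fst c; pull_rel fst d] i.
Let Xs (s : seq nat) : rel (T * T) := fun x y => all (fun i => X i x y) s.
Let h (s : seq nat) := ent q (Xs s).

Let ab_equiv : equiv ab. Proof. exact: equiv_meet. Qed.
Let q_pmf : finite_pmf q. Proof. exact: copy_pmfP. Qed.

Let X_equiv i : equiv (X i).
Proof. by case: i => [|[|[|[|i]]]]; rewrite /X /=; [| | | |rewrite nth_nil]; apply: equiv_pull. Qed.

Let Xs_equiv s : equiv (Xs s).
Proof.
elim: s => [|i s IHs]; first by split.
exact: (equiv_meet (X_equiv i) IHs).
Qed.

Let h_submod s t u m : {subset u <= s ++ t} -> {subset s ++ t <= u} ->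
  {subset m <= s} -> {subset m <= t} -> h u + h m <= h s + h t.
Proof.
move=> u1 u2 ms mt; apply: (ent_submod q_pmf) => //.
- move=> x y; rewrite -all_cat; apply/idP/idP => /allP H; apply/allP => i iH.
    by apply: H; apply: u2.
  by apply: H; apply: u1.
- by move=> x y /allP H; apply/allP => i /ms; apply: H.
- by move=> x y /allP H; apply/allP => i /mt; apply: H.
Qed.

Let h_fst s r : (forall x y, 0 < q x -> 0 < q y -> Xs s x y = r x.1 y.1) -> h s = ent p r.
Proof. by move=> E; rewrite -(ent_fst p_pmf ab_equiv r); apply: eq_ent. Qed.

Let h_snd s r : (forall x y, 0 < q x -> 0 < q y -> Xs s x y = r x.2 y.2) -> h s = ent p r.
Proof. by move=> E; rewrite -(ent_snd p_pmf ab_equiv r); apply: eq_ent. Qed.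

Let supp x : 0 < q x -> a x.1 x.2 /\ b x.1 x.2.
Proof. by rewrite /q /copy_pmf /ab /meet_rel; case: ifP => [/andP[]|]; rewrite ?ltxx. Qed.

Let swap_on (r : rel T) : equiv r -> (r = a) \/ (r = b) ->
  forall x y, 0 < q x -> 0 < q y -> r x.1 y.1 = r x.2 y.2.
Proof.
move=> [rr rs rt] rab x y /supp[xa xb] /supp[ya yb].
have [rx ry] : r x.1 x.2 /\ r y.1 y.2 by case: rab => ->.
apply/idP/idP => H.
  by apply: (rt x.1); [rewrite rs | exact: (rt y.1)].
by apply: (rt x.2) => //; apply: (rt y.2) => //; rewrite rs.
Qed.

(** On the space of the copy, [I1] to [I11] are submodularity.  In their sum all
    entropies that involve both [w] and [c] or [d] cancel, except for that of
    all five variables, which the conditional independence of [w] determines;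
    the remaining ones that involve [w] agree with those of [c]. *)
Lemma ent_zhang_yeung : 
  2 * (ent p a + ent p b) + ent p c + ent p (meet_rel c d)
    + 4 * ent p (meet_rel ab c) + ent p (meet_rel ab d) <=
  3 * (ent p ab + ent p (meet_rel a c) + ent p (meet_rel b c))
    + ent p (meet_rel a d) + ent p (meet_rel b d).
Proof.
have sub s t u m : (all (mem (s ++ t)) u) && (all (mem u) (s ++ t)) && all (mem s) m
    && all (mem t) m -> h u + h m <= h s + h t.
  by case/andP=> /andP[/andP[/allP u1 /allP u2] /allP ms] /allP mt; apply: h_submod.
have I1 := sub [:: 0; 2; 4]%N [:: 1; 2; 4]%N [:: 0; 1; 2; 4]%N [:: 2; 4]%N isT.
have I2 := sub [:: 0; 3; 4]%N [:: 1; 3; 4]%N [:: 0; 1; 3; 4]%N [:: 3; 4]%N isT.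
have I3 := sub [:: 0; 1; 2; 3]%N [:: 1; 2; 3; 4]%N [:: 0; 1; 2; 3; 4]%N [:: 1; 2; 3]%N isT.
have I4 := sub [:: 1; 2; 3]%N [:: 2; 3; 4]%N [:: 1; 2; 3; 4]%N [:: 2; 3]%N isT.
have I5 := sub [:: 2; 4]%N [:: 3; 4]%N [:: 2; 3; 4]%N [:: 4]%N isT.
have I6 := sub [:: 0; 2]%N [:: 0; 4]%N [:: 0; 2; 4]%N [:: 0]%N isT.
have I7 := sub [:: 1; 2]%N [:: 1; 4]%N [:: 1; 2; 4]%N [:: 1]%N isT.
have I8 := sub [:: 0; 1; 2; 3]%N [:: 0; 1; 3; 4]%N [:: 0; 1; 2; 3; 4]%N [:: 0; 1; 3]%N isT.
have I9 := sub [:: 0; 3]%N [:: 0; 4]%N [:: 0; 3; 4]%N [:: 0]%N isT.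
have I10 := sub [:: 1; 3]%N [:: 1; 4]%N [:: 1; 3; 4]%N [:: 1]%N isT.
have I11 := sub [:: 0; 1; 2; 3]%N [:: 0; 1; 2; 4]%N [:: 0; 1; 2; 3; 4]%N [:: 0; 1; 2]%N isT.
have e0 : h [:: 0%N] = ent p a by apply: h_fst => x y _ _; rewrite /Xs /= andbT.
have e1 : h [:: 1%N] = ent p b by apply: h_fst => x y _ _; rewrite /Xs /= andbT.
have e4 : h [:: 4%N] = ent p c by apply: h_snd => x y _ _; rewrite /Xs /= andbT.
have e02 : h [:: 0; 2]%N = ent p (meet_rel a c).
  by apply: h_fst => x y _ _; rewrite /Xs /= andbT.
have e03 : h [:: 0; 3]%N = ent p (meet_rel a d).
  by apply: h_fst => x y _ _; rewrite /Xs /= andbT.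
have e12 : h [:: 1; 2]%N = ent p (meet_rel b c).
  by apply: h_fst => x y _ _; rewrite /Xs /= andbT.
have e13 : h [:: 1; 3]%N = ent p (meet_rel b d).
  by apply: h_fst => x y _ _; rewrite /Xs /= andbT.
have e23 : h [:: 2; 3]%N = ent p (meet_rel c d).
  by apply: h_fst => x y _ _; rewrite /Xs /= andbT.
have e012 : h [:: 0; 1; 2]%N = ent p (meet_rel ab c).
  by apply: h_fst => x y _ _; rewrite /Xs /= andbT /meet_rel /ab /meet_rel andbA.
have e013 : h [:: 0; 1; 3]%N = ent p (meet_rel ab d).
  by apply: h_fst => x y _ _; rewrite /Xs /= andbT /meet_rel /ab /meet_rel andbA.
have e04 : h [:: 0; 4]%N = ent p (meet_rel a c).
  apply: h_snd => x y qx qy; rewrite /Xs /= andbT.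
  by rewrite /X /= /pull_rel (swap_on a_equiv (or_introl erefl)).
have e14 : h [:: 1; 4]%N = ent p (meet_rel b c).
  apply: h_snd => x y qx qy; rewrite /Xs /= andbT.
  by rewrite /X /= /pull_rel (swap_on b_equiv (or_intror erefl)).
(* the independence of [w] and [c, d] given [a, b] *)
have e01234 : h [:: 0; 1; 2; 3; 4]%N =
    h [:: 0; 1; 2; 3]%N + ent p (meet_rel ab c) - ent p ab.
  have abcd_equiv : equiv (meet_rel (meet_rel ab c) d) by exact: equiv_meet (equiv_meet ab_equiv c_equiv) d_equiv.
  have -> : h [:: 0; 1; 2; 3]%N = ent p (meet_rel (meet_rel ab c) d).
    by apply: h_fst => x y _ _; rewrite /Xs /= andbT /meet_rel /ab /meet_rel !andbA.
  rewrite -(ent_copy p_pmf ab_equiv abcd_equiv _ c_equiv); last first.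
    by move=> x y /andP[/andP[]].
  apply: eq_ent => // x y _ _.
  by rewrite /Xs /= andbT /meet_rel /pull_rel /ab /meet_rel !andbA.
lra.
Qed.

End ZhangYeung.

(** * Entropic functions of finite probability spaces *)

Section FiniteEntropic.
Context {R : realType} {V : finType}.
Implicit Types (h g : {set V} -> R) (U W : {set V}).

Definition same (T : finType) (X : V -> T -> nat) U : rel T :=
  fun x y => [forall v in U, X v x == X v y].

Definition finite_entropic h : Prop :=
  exists (T : finType) (p : T -> R) (X : V -> T -> nat),
    finite_pmf p /\ forall U, h U = ent p (same X U) / ln 2.

Lemma sameP (T : finType) (X : V -> T -> nat) U x y :
  reflect (forall v, v \in U -> X v x = X v y) (same X U x y).
Proof. by apply: (iffP forall_inP) => H v vU; apply/eqP; apply: H. Qed.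

Lemma same_equiv (T : finType) (X : V -> T -> nat) U : equiv (same X U).
Proof.
split=> [x|x y|y x z].
- exact/sameP.
- by apply/sameP/sameP => H v vU; rewrite H.
- by move=> /sameP xy /sameP yz; apply/sameP => v vU; rewrite xy // yz.
Qed.

Lemma sameU (T : finType) (X : V -> T -> nat) U W x y :
  same X (U :|: W) x y = same X U x y && same X W x y.
Proof.
apply/sameP/andP => [H|[/sameP HU /sameP HW] v].
  by split; apply/sameP => v vU; apply: H; rewrite inE vU ?orbT.
by rewrite inE => /orP[/HU|/HW].
Qed.

Lemma sameS (T : finType) (X : V -> T -> nat) U W x y :
  U \subset W -> same X W x y -> same X U x y.
Proof. by move=> /fintype.subsetP UW /sameP H; apply/sameP => v /UW/H. Qed.

Lemma ln2_gt0 : 0 < ln 2 :> R.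
Proof. by rewrite ln_gt0 // ltr1n. Qed.

Lemma finite_entropic_polymatroid h : finite_entropic h -> polymatroid h.
Proof.
case=> T [p [X [p_pmf hE]]]; have l2 : 0 <= (ln 2)^-1 :> R by rewrite invr_ge0 ltW ?ln2_gt0.
split.
- by move=> U; rewrite hE mulr_ge0 // ent_ge0.
- by rewrite hE (ent_trivial p_pmf) ?mul0r // => x y; apply/sameP => v; rewrite inE.
- move=> U W; rewrite !hE ler_wpM2r //; apply: (le_ent p_pmf).
    by case: (same_equiv X (U :|: W)).
  by move=> x y; apply: sameS; apply: finset.subsetUl.
- move=> U W; rewrite !hE -!mulrDl ler_wpM2r //.
  apply: (ent_submod p_pmf); try exact: same_equiv.
  + exact: sameU.
  + by move=> x y; apply: sameS; apply: finset.subsetIl.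
  + by move=> x y; apply: sameS; apply: finset.subsetIr.
Qed.

Lemma finite_entropic0 : finite_entropic (fun=> 0).
Proof.
have one_pmf : finite_pmf (fun _ : unit => 1 : R).
  by split=> [_|]; [apply: ler01 | rewrite sumr_const card_unit].
exists unit, (fun=> 1), (fun _ _ => 0%N); split=> // U.
by rewrite (ent_trivial one_pmf) ?mul0r // => x y; apply/sameP.
Qed.

Lemma finite_entropicD h g :
  finite_entropic h -> finite_entropic g -> finite_entropic (fun U => h U + g U).
Proof.
case=> T1 [p1 [X1 [pmf1 hE]]] [T2 [p2 [X2 [pmf2 gE]]]].
have [p10 p11] := pmf1; have [p20 p21] := pmf2.
pose p (z : T1 * T2) := p1 z.1 * p2 z.2.
exists (T1 * T2)%type, p, (fun v z => pickle (X1 v z.1, X2 v z.2)); split.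
  split; first by move=> z; apply: mulr_ge0.
  rewrite -(pair_bigA _ (fun x y => p1 x * p2 y)) /=.
  by rewrite -[RHS]p11; apply: eq_bigr => x _; rewrite -big_distrr /= p21 mulr1.
set X := fun v z => pickle _.
move=> U; rewrite hE gE -mulrDl; congr (_ / _).
set r := same X U.
have rE x y : r x y = same X1 U x.1 y.1 && same X2 U x.2 y.2.
  apply/sameP/andP => [H|[/sameP H1 /sameP H2] v vU]; last by rewrite /X H1 // H2.
  by split; apply/sameP => v /H/(pcan_inj pickleK)[].
have mE z : mass p r z = mass p1 (same X1 U) z.1 * mass p2 (same X2 U) z.2.
  rewrite /mass big_distrlr /= pair_big_dep /=.
  by apply: eq_bigl => y; rewrite rE.
rewrite /ent -opprD; congr (- _).
have -> : \sum_x p1 x * ln (mass p1 (same X1 U) x) =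
    \sum_z p z * ln (mass p1 (same X1 U) z.1).
  rewrite -(pair_bigA _ (fun x y => p1 x * p2 y * ln (mass p1 (same X1 U) x))) /=.
  apply: eq_bigr => x _; under [RHS]eq_bigr do rewrite mulrAC.
  by rewrite -big_distrr /= p21 mulr1.
have -> : \sum_x p2 x * ln (mass p2 (same X2 U) x) =
    \sum_z p z * ln (mass p2 (same X2 U) z.2).
  rewrite -(pair_bigA _ (fun x y => p1 x * p2 y * ln (mass p2 (same X2 U) y))) /=.
  rewrite exchange_big /=; apply: eq_bigr => y _; under [RHS]eq_bigr do rewrite -mulrA.
  by rewrite -big_distrl /= p11 mul1r.
rewrite -big_split; apply: eq_bigr => z _ /=; rewrite mE -mulrDr.
have [->|z0] := eqVneq (p z) 0; first by rewrite !mul0r.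
have [z1 z2] : p1 z.1 != 0 /\ p2 z.2 != 0 by move: z0; rewrite /p mulf_eq0 negb_or => /andP[].
have [r1 _ _] := same_equiv X1 U; have [r2 _ _] := same_equiv X2 U.
by rewrite lnM ?posrE // mass_gt0 // lt_neqAle eq_sym ?z1 ?z2 ?p10 ?p20.
Qed.

Lemma finite_entropic_muln h n : finite_entropic h -> finite_entropic (fun U => n%:R * h U).
Proof.
move=> hF; elim: n => [|n IHn].
  under boolp.eq_fun do rewrite mul0r; exact: finite_entropic0.
under boolp.eq_fun do rewrite -addn1 natrD mulrDl mul1r.
exact: finite_entropicD.
Qed.

(** Revealing the variables only with probability [t], in which case this is
    visible from each of them, scales the entropies by [t] up to the entropy of
    the decision. *)
Lemma finite_entropic_switch h t : 0 < t -> t < 1 -> finite_entropic h ->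
  finite_entropic (fun U => if U == finset.set0 then 0 else
    t * h U - (t * ln t + (1 - t) * ln (1 - t)) / ln 2).
Proof.
move=> t0 t1 [T [p [X [p_pmf hE]]]]; have [p0 p1] := p_pmf.
have sum_opt (F : option T -> R) : \sum_z F z = F None + \sum_x F (Some x).
  rewrite (bigD1 None) //=; congr (_ + _).
  rewrite (reindex_omap Some id); last by case.
  by apply: eq_bigl => x; rewrite eqxx.
pose q (z : option T) := if z is Some x then t * p x else 1 - t.
pose Y v (z : option T) := if z is Some x then (X v x).+1 else 0%N.
have q_pmf : finite_pmf q.
  split; first by case=> [x|] /=; [rewrite mulr_ge0 // ltW | rewrite subr_ge0 ltW].
  by rewrite sum_opt /= -big_distrr /= p1 mulr1 subrK.
exists (option T), q, Y; split=> // U.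
case: eqP => [->|/eqP/set0Pn[u uU]].
  by rewrite (ent_trivial q_pmf) ?mul0r // => x y; apply/sameP => v; rewrite inE.
have same_some x y : same Y U (Some x) (Some y) = same X U x y.
  by apply/sameP/sameP => H v vU; [case: (H v vU) | rewrite /Y H].
have mS x : mass q (same Y U) (Some x) = t * mass p (same X U) x.
  rewrite /mass big_mkcond sum_opt /= ifN ?add0r; last first.
    by apply/negP => /sameP/(_ u uU).
  by rewrite big_distrr [RHS]big_mkcond; apply: eq_bigr => y _; rewrite same_some.
have mN : mass q (same Y U) None = 1 - t.
  rewrite /mass big_mkcond sum_opt /= ifT; last exact/sameP.
  rewrite big1 ?addr0 // => y _; rewrite ifN //.
  by apply/negP => /sameP/(_ u uU).
rewrite hE /ent sum_opt mN /=.
have -> : \sum_x t * p x * ln (mass q (same Y U) (Some x)) =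
    t * ln t + t * \sum_x p x * ln (mass p (same X U) x).
  rewrite -[X in X + _]mulr1 -p1 !big_distrr -big_split /=.
  apply: eq_bigr => x _; rewrite mS.
  have [->|px] := eqVneq (p x) 0; first by rewrite !(mulr0, mul0r) addr0.
  have [r1 _ _] := same_equiv X U.
  rewrite lnM ?posrE //; first by ring.
  by apply: mass_gt0 => //; rewrite lt_neqAle eq_sym px p0.
by ring.
Qed.

(** The choice of [t] makes [- t ln t] equal to [2 t ln n], which is at most
    [2 / n]. *)
Lemma switch_cost (n : nat) (t : R) : (1 < n)%N -> t = (n%:R ^+ 2)^-1 ->
  0 <= - (t * ln t + (1 - t) * ln (1 - t)) <= 3 / n%:R.
Proof.
move=> n1 tE; have n0 : 0 < n%:R :> R by rewrite ltr0n ltnW.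
have n1' : 1 < n%:R :> R by rewrite ltr1n.
have t0 : 0 < t by rewrite tE invr_gt0 exprn_gt0.
have t1 : t < 1 by rewrite tE invf_lt1 ?exprn_gt0 // exprn_egt1.
have lt : ln t = - (2 * ln n%:R).
  by rewrite tE lnV ?posrE ?exprn_gt0 // lnXn // mulr2n mulrDl mul1r.
have ln0 : 0 <= ln n%:R :> R by rewrite ln_ge0 // ltW.
have l1 : ln (1 - t) <= 0 by rewrite ln_le0 //; lra.
apply/andP; split.
  rewrite opprD addr_ge0 // -mulrN mulr_ge0 //; rewrite ?lt; lra.
have a : - (t * ln t) <= 2 / n%:R.
  rewrite lt mulrN opprK; have := ln_sublinear n0 => /ltW lnn.
  apply: (@le_trans _ _ (t * (2 * n%:R))); first by rewrite !ler_wpM2l // ltW.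
  rewrite tE expr2 invfM mulrCA -!mulrA mulVf ?mulr1 //; exact: lt0r_neq0.
have b : - ((1 - t) * ln (1 - t)) <= 1 / n%:R.
  have u0 : 0 < 1 - t by lra.
  have := @le_ln1Dx R ((1 - t)^-1 - 1).
  rewrite addrCA subrr addr0 ltrBrDl subrr invr_gt0 => /(_ u0).
  rewrite lnV ?posrE // => le_t.
  have : (1 - t) * - ln (1 - t) <= (1 - t) * ((1 - t)^-1 - 1) by apply: ler_wpM2l; [exact: ltW | exact: le_t].
  rewrite mulrBr divff ?lt0r_neq0 // mulr1 mulrN opprB addrCA subrr addr0 => /le_trans; apply.
  rewrite mul1r tE lef_pV2 ?posrE ?exprn_gt0 //.
  by rewrite expr2 ler_peMl // ltW.
rewrite opprD; apply: le_trans (lerD a b) _; lra.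
Qed.

(** Take many independent copies and reveal them with small probability: the
    cost of the switch vanishes. *)
Lemma finite_entropic_scale (N : nat) h : (0 < N)%N -> finite_entropic h ->
  approximable finite_entropic (fun U => h U / N%:R).
Proof.
move=> N0 hF e e0.
have [m mP] : exists m : nat, 3 / (ln 2 * e) < m%:R.
  exists (Num.bound (3 / (ln 2 * e) : R)).
  by rewrite archi_boundP // divr_ge0 // mulr_ge0 ?ltW // ln2_gt0.
pose n := (N * m.+2)%N; have n1 : (1 < n)%N by rewrite /n; nia.
have nm : (m <= n)%N by rewrite /n; nia.
have nN : n%:R = N%:R * m.+2%:R :> R by rewrite natrM.
pose t : R := (n%:R ^+ 2)^-1.
have n0 : 0 < n%:R :> R by rewrite ltr0n ltnW.
have N0' : 0 < N%:R :> R by rewrite ltr0n.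
have t0 : 0 < t by rewrite invr_gt0 exprn_gt0.
have t1 : t < 1 by rewrite invf_lt1 ?exprn_gt0 // exprn_egt1 // ltr1n.
exists (fun U => if U == finset.set0 then 0 else
    t * ((N * m.+2 ^ 2)%:R * h U) - (t * ln t + (1 - t) * ln (1 - t)) / ln 2).
  by apply: finite_entropic_switch => //; apply: finite_entropic_muln.
have [_ h0 _ _] := finite_entropic_polymatroid hF.
move=> U; case: eqP => [->|_]; first by rewrite h0 mul0r subrr normr0.
have -> : t * ((N * m.+2 ^ 2)%:R * h U) = h U / N%:R.
  rewrite /t nN natrM natrX; field.
  by rewrite !lt0r_neq0 // ltr0n.
have /andP[c0 c3] := @switch_cost n t n1 erefl.
rewrite opprB addrC subrK -normrN -mulNr ger0_norm; last first.
  by rewrite divr_ge0 // ltW ?ln2_gt0.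
rewrite ltr_pdivrMr ?ln2_gt0 //; apply: le_lt_trans c3 _.
rewrite ltr_pdivrMr //; move: mP; rewrite ltr_pdivrMr ?mulr_gt0 ?ln2_gt0 // => mP.
have : m%:R <= n%:R :> R by rewrite ler_nat.
have l2 := ln2_gt0; have le0 : 0 < ln 2 * e by rewrite mulr_gt0.
move=> mn; apply: lt_le_trans mP _; rewrite (mulrC e) [leRHS]mulrC.
by apply: ler_wpM2r => //; exact: ltW.
Qed.

End FiniteEntropic.

Lemma finite_entropic_zhang_yeung (R : realType) (h : {set G32} -> R) p q :
  finite_entropic h -> zhang_yeung h p q.
Proof.
case=> T [P [X [P_pmf hE]]]; rewrite /zhang_yeung !hE.
have E s t : same X (vset (s ++ t)) = meet_rel (same X (vset s)) (same X (vset t)).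
  by apply: boolp.funext => x; apply: boolp.funext => y; rewrite vset_cat sameU.
have E2 i j : same X (vset [:: i; j]) = meet_rel (same X (vset [:: i])) (same X (vset [:: j])).
  exact: (E [:: i] [:: j]).
have E3 i j k : same X (vset [:: i; j; k]) = meet_rel (meet_rel (same X (vset [:: i]))
    (same X (vset [:: j]))) (same X (vset [:: k])).
  by rewrite -E2; apply: (E [:: i; j] [:: k]).
rewrite !E2 !E3.
have := ent_zhang_yeung P_pmf (same_equiv X (vset [:: 0%N])) (same_equiv X (vset [:: 1%N]))
  (same_equiv X (vset [:: p])) (same_equiv X (vset [:: q])).
have l2 : 0 <= (ln 2)^-1 :> R by rewrite invr_ge0 ltW ?ln2_gt0.
move/(ler_wpM2r l2); lra.
Qed.

(** * Entropies of two fair bits *)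

Section TwoBits.
Context {R : realType}.

Definition half (_ : bool) : R := 1 / 2.
Definition quarter (_ : bool * bool) : R := 1 / 4.

Lemma sum_bool (F : bool -> R) : \sum_x F x = F true + F false.
Proof. by rewrite (bigD1 true) //= (bigD1 false) //= big_pred0 ?addr0 //; case. Qed.

Lemma sum_bool2 (F : bool * bool -> R) :
  \sum_x F x = F (true, true) + F (true, false) + (F (false, true) + F (false, false)).
Proof.
rewrite (eq_bigr (fun z => F (z.1, z.2))); last by case.
by rewrite -(pair_bigA _ (fun x y => F (x, y))) /= !sum_bool.
Qed.

Lemma half_pmf : finite_pmf half.
Proof. by split=> [x|]; rewrite ?sum_bool /half; lra. Qed.

Lemma quarter_pmf : finite_pmf quarter.
Proof. by split=> [x|]; rewrite ?sum_bool2 /quarter; lra. Qed.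

(** Entropy of a point of a class of [k] points among four, in bits. *)
Definition bits4 (k : nat) : R := - ln (k%:R / 4) / ln 2.

Lemma bits4_1 : bits4 1 = 2.
Proof.
have l2 := @ln2_gt0 R; rewrite /bits4 mul1r lnV ?posrE // opprK.
rewrite (_ : 4 = 2 ^+ 2 :> R) ?lnXn //; last by ring.
by rewrite mulr2n mulrDl divff ?lt0r_neq0.
Qed.

Lemma bits4_2 : bits4 2 = 1.
Proof.
have l2 := @ln2_gt0 R; rewrite /bits4 (_ : 2 / 4 = 2^-1 :> R); last by field.
by rewrite lnV ?posrE // opprK divff ?lt0r_neq0.
Qed.

Lemma bits4_4 : bits4 4 = 0.
Proof. by rewrite /bits4 divff // ln1 oppr0 mul0r. Qed.

Definition count4 (r : rel (bool * bool)) (x : bool * bool) : nat :=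
  r x (true, true) + r x (true, false) + (r x (false, true) + r x (false, false)).

Lemma ent_quarter r : ent quarter r / ln 2 =
  (bits4 (count4 r (true, true)) + bits4 (count4 r (true, false)) +
   (bits4 (count4 r (false, true)) + bits4 (count4 r (false, false)))) / 4.
Proof.
have mE x : mass quarter r x = (count4 r x)%:R / 4.
  rewrite /mass big_mkcond sum_bool2 /count4 !natrD /quarter.
  by case: (r x _); case: (r x _); case: (r x _); case: (r x _) => /=; lra.
by rewrite /ent sum_bool2 /quarter !mE /bits4; field; rewrite lt0r_neq0 ?ln2_gt0.
Qed.

Lemma finite_entropic_step (V : finType) (K : {set V}) :
  finite_entropic (step K : {set V} -> R).
Proof.
exists bool, half, (fun v b => (v \in K) && b : nat); split; first exact: half_pmf.
move=> U; have l2 := @ln2_gt0 R.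
pose X (v : V) (b : bool) : nat := (v \in K) && b.
have mE b : mass half (same X U) b =
    (if same X U b true then 1 / 2 else 0) + (if same X U b false then 1 / 2 else 0).
  by rewrite /mass big_mkcond sum_bool.
rewrite -/X /ent sum_bool stepE !mE /half.
have rfl b : same X U b b by apply/sameP.
have sE b b' : b != b' -> same X U b b' = (U :&: K == finset.set0).
  move=> bb'; apply/sameP/eqP => [H|UK v vU].
    apply/setP => v; rewrite !inE; apply/negP => /andP[vU vK].
    by have := H v vU; rewrite /X vK /=; case: b b' bb' {H} => [] [].
  have : v \notin U :&: K by rewrite UK inE.
  by rewrite /X inE vU /= => /negbTE->.
rewrite !rfl !sE //; case: eqP => _ /=.
  rewrite (_ : 1 / 2 + 1 / 2 = 1 :> R); last by field.
  by rewrite ln1 !(mulr0, addr0, oppr0, mul0r).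
rewrite addr0 add0r div1r lnV ?posrE //; field.
exact: lt0r_neq0.
Qed.

Definition core_family (X : nat -> bool * bool -> nat) (v : G32) : bool * bool -> nat :=
  if (idx v < 5)%N then X (idx v) else fun=> 0%N.

Lemma same_core X (U : {set G32}) x y : same (core_family X) U x y =
  [&& (vtx 0 \in U) ==> (X 0%N x == X 0%N y), (vtx 1 \in U) ==> (X 1%N x == X 1%N y),
      (vtx 2 \in U) ==> (X 2%N x == X 2%N y), (vtx 3 \in U) ==> (X 3%N x == X 3%N y)
    & (vtx 4 \in U) ==> (X 4%N x == X 4%N y)].
Proof.
apply/sameP/and5P => [H|[H0 H1 H2 H3 H4] v vU].
  by split; apply/implyP => /H; rewrite /core_family !vtxK //= => ->.
rewrite /core_family; case: ltnP => // v5.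
move: vU; rewrite -(idxK v); case: (idx v) v5 => [|[|[|[|[|//]]]]] _ vU; rewrite ?vtxK //; apply/eqP.
- by rewrite vU in H0.
- by rewrite vU in H1.
- by rewrite vU in H2.
- by rewrite vU in H3.
- by rewrite vU in H4.
Qed.

Definition xor_family (k i : nat) (x : bool * bool) : nat :=
  if i == k then (x.1 + x.2.*2)%N
  else match i with 0 => x.1 | 1 => x.2 | 4 => x.1 (+) x.2 | _ => false end.

Lemma finite_entropic_xor k : (k == 2)%N || (k == 3)%N ->
  finite_entropic (fun U => (xor_rank k U)%:R : R).
Proof.
move=> k23; exists (bool * bool)%type, quarter, (core_family (xor_family k)).
split=> [|U]; first exact: quarter_pmf.
rewrite ent_quarter /count4 !same_core /xor_rank.
case/orP: k23 => /eqP->; case: (vtx 0 \in U); case: (vtx 1 \in U); case: (vtx 2 \in U);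
  case: (vtx 3 \in U); case: (vtx 4 \in U); rewrite /= ?(addn0, add0n, addnS) ?bits4_1 ?bits4_2 ?bits4_4 /minn /=; lra.
Qed.

(** C and D are independent bits, A is their conjunction and B their
    disjunction; with I(C;D) = I(A;B|C) = I(A;B|D) = 0 and I(A;B) > 0 this
    violates the Ingleton inequality. *)
Definition andor_family (i : nat) (x : bool * bool) : nat :=
  match i with 0 => x.1 && x.2 | 1 => x.1 || x.2 | 2 => x.1 | 3 => x.2 | _ => false end.

Definition andor_value (a b c d : bool) : R :=
  if c && d || a && b && (c || d) then 2
  else if (a || b) && (c || d) || a && b then 3 / 2
  else if c || d then 1 else if a || b then (bits4 1 + 3 * bits4 3) / 4 else 0.

Definition andor (U : {set G32}) : R :=
  andor_value (vtx 0 \in U) (vtx 1 \in U) (vtx 2 \in U) (vtx 3 \in U).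

Lemma finite_entropic_andor : finite_entropic andor.
Proof.
exists (bool * bool)%type, quarter, (core_family andor_family).
split=> [|U]; first exact: quarter_pmf.
rewrite ent_quarter /count4 !same_core /andor /andor_value.
case: (vtx 0 \in U); case: (vtx 1 \in U); case: (vtx 2 \in U);
  case: (vtx 3 \in U); case: (vtx 4 \in U); rewrite /= ?(addn0, add0n, addnS) ?bits4_1 ?bits4_2 ?bits4_4; lra.
Qed.

Lemma andor_conj : 4 / 5 <= (bits4 1 + 3 * bits4 3) / 4 <= 1.
Proof.
have l2 := @ln2_gt0 R; have l2' := lt0r_neq0 l2.
have E : bits4 3 = 2 - ln 3 / ln 2.
  rewrite /bits4 ln_div ?posrE // (_ : 4 = 2 ^+ 2 :> R) ?lnXn //; last by ring.
  by rewrite mulr2n; field.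
(* 3 ^ 5 <= 2 ^ 8 and 2 ^ 4 <= 3 ^ 3 *)
have up : ln 3 *+ 5 <= ln 2 *+ 8 :> R.
  by rewrite -!lnXn // ler_ln ?posrE ?exprn_gt0 // -!natrX ler_nat.
have lo : ln 2 *+ 4 <= ln 3 *+ 3 :> R.
  by rewrite -!lnXn // ler_ln ?posrE ?exprn_gt0 // -!natrX ler_nat.
have up' : ln 3 / ln 2 <= 8 / 5 :> R by rewrite ler_pdivrMr //; lra.
have lo' : 4 / 3 <= ln 3 / ln 2 :> R by rewrite ler_pdivlMr //; lra.
by rewrite bits4_1 E; apply/andP; split; lra.
Qed.

End TwoBits.

Local Open Scope classical_set_scope.

(** * Discrete random variables *)

Lemma le_esum_scale (R : realType) (S : choiceType) (A : set S) (a : S -> \bar R) (c : R) :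
  0 <= c -> (forall z, (0 <= a z)%E) ->
  (c%:E * (\esum_(z in A) a z) <= \esum_(z in A) (c%:E * a z))%E.
Proof.
rewrite le_eqVlt => /predU1P[<-|c0] a0.
  by rewrite mul0e esum_ge0 // => z _; rewrite mul0e.
rewrite -lee_pdivlMl //; apply: ge_ereal_sup => _ [F [finF FA] <-].
rewrite lee_pdivlMl // ge0_mule_fsumr //.
by apply: esum_ge; exists F.
Qed.

Section Discrete.
Context d (T : measurableType d) (R : realType) (P : probability T R).
Variables (S : choiceType) (K : T -> S).
Hypotheses (K_countable : countable (range K))
  (K_fiber : forall z, measurable (K @^-1` [set z])).

Lemma discrete_preimage (B : set S) : measurable (K @^-1` B).
Proof.
have /countable_injP[g gI] := K_countable.
have -> : K @^-1` B = \bigcup_(n in g @` (range K `&` B)) (K @^-1` [set z | range K z /\ g z = n]).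
  apply/seteqP; split=> [x Bx|x [n [z [Kz Bz] <-]] [Kx gx]] /=.
    exists (g (K x)); first by exists (K x) => //; split=> //; exists x.
    by split=> //; exists x.
  by rewrite (gI (K x) z) ?inE.
apply: bigcup_measurable => n [z [Kz Bz] <-].
rewrite (_ : _ @^-1` _ = K @^-1` [set z]); first exact: K_fiber.
apply/seteqP; split=> x /=; last by move=> ->.
by case=> Kx gx; apply: gI; rewrite ?inE.
Qed.

Lemma discrete_measure (A : set T) : measurable A ->
  P A = (\esum_(z in range K) P (A `&` K @^-1` [set z]))%E.
Proof.
move=> mA; have /countable_injP[g gI] := K_countable.
pose F n := A `&` K @^-1` [set z | range K z /\ g z = n].
have FE z : range K z -> F (g z) = A `&` K @^-1` [set z].
  move=> Kz; apply/seteqP; split=> x [Ax] /=.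
    by case=> Kx gx; split=> //; apply: gI; rewrite ?inE.
  by move=> Kxz; split=> //=; rewrite Kxz.
have -> : A = \bigcup_(n in g @` range K) F n.
  apply/seteqP; split=> [x Ax|x [n _ []]//].
  by exists (g (K x)); [exists (K x) => //; exists x | split=> //; split=> //; exists x].
rewrite measure_bigcup.
- rewrite nneseries_esum // set_mem_set esum_image; last exact: gI.
  apply: eq_esum => z Kz; rewrite FE //; congr (P (_ `&` _)).
  apply/seteqP; split=> [x Ax|x [n _ []]//].
  by exists (g (K x)); [exists (K x) => //; exists x | split=> //; split=> //; exists x].
- by move=> n [z Kz <-]; rewrite FE //; apply: measurableI.
- by move=> i j _ _ [x [[_ [_ <-]] [_ [_ <-]]]].
Qed.

End Discrete.

Lemma countable_ffun (V : finType) (S : choiceType) (B : V -> set S) :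
  (forall v, countable (B v)) -> countable [set f : {ffun V -> S} | forall v, B v (f v)].
Proof.
move=> /(_ _)/countable_injP/boolp.cid-/all_sig[g gI].
apply/countable_injP; exists (fun f => pickle [ffun v => g v (f v)]).
move=> f f'; rewrite !inE => fB fB' /(pcan_inj pickleK)/ffunP E.
by apply/ffunP => v; have := E v; rewrite !ffunE; apply: gI; rewrite inE.
Qed.

Section Truncation.
Context {R : realType} {V : finType}.
Context d (T : measurableType d) (P : probability T R) (Y : V -> {dRV P >-> R}).

Let J (x : T) : {ffun V -> R} := [ffun v => Y v x].

Let J_countable : countable (range J).
Proof.
apply: (@sub_countable _ _ _ [set f : {ffun V -> R} | forall v, range (Y v) (f v)]).
  by apply: subset_card_le => _ [x _ <-] v; rewrite ffunE; exists x.
by apply: (@countable_ffun _ _ (fun v => range (Y v))) => v; apply: countable_range.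
Qed.

Let J_fiber f : measurable (J @^-1` [set f]).
Proof.
have -> : J @^-1` [set f] = \bigcap_(v in [set: V]) (Y v @^-1` [set f v]).
  apply/seteqP; split=> [x /= <- v _|x Jx] /=; first by rewrite ffunE.
  by apply/ffunP => v; rewrite ffunE; apply: Jx.
apply: fin_bigcap_measurable; first exact: finite_finset.
by move=> v _; rewrite -[X in measurable X]setTI; apply: measurable_funPT.
Qed.

Let J_preimage B : measurable (J @^-1` B). Proof. exact: discrete_preimage. Qed.

(** The distribution of the whole family. *)
Let mu (B : set {ffun V -> R}) : R := fine (P (J @^-1` B)).

Let muE B : P (J @^-1` B) = (mu B)%:E.
Proof. by rewrite /mu fineK // fin_num_measure. Qed.

Let mu_ge0 B : 0 <= mu B. Proof. by rewrite fine_ge0. Qed.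

Let muS B C : B `<=` C -> mu B <= mu C.
Proof. by move=> BC; rewrite -lee_fin -!muE le_measure ?inE // => x; apply: BC. Qed.

Let muT : mu setT = 1.
Proof. by rewrite /mu preimage_setT probability_setT. Qed.

Let mu_sum (U : finType) (phi : {ffun V -> R} -> U) (B : set {ffun V -> R}) (Q : pred U) :
  \sum_(u | Q u) mu (B `&` [set y | phi y = u]) = mu (B `&` [set y | Q (phi y)]).
Proof.
rewrite -big_filter; set s := [seq u <- _ | Q u].
have us : uniq s by rewrite filter_uniq ?index_enum_uniq.
have -> : B `&` [set y | Q (phi y)] = B `&` [set y | phi y \in s].
  apply/seteqP; split=> y [By] /=; first by rewrite /s mem_filter mem_index_enum andbT.
  by rewrite /s mem_filter => /andP[].
elim: s us => [|u s IHs] /=.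
  rewrite big_nil (_ : _ `&` _ = set0) /mu ?preimage_set0 ?measure0 //.
  by apply/seteqP; split=> y // -[].
case/andP=> us /IHs; rewrite big_cons => ->; apply/EFin_inj; rewrite EFinD -!muE.
rewrite -measureU //.
  congr (P _); apply/seteqP; split=> x /=.
    by case=> [[Bx ->]|[Bx xs]]; split=> //; rewrite inE ?eqxx ?xs ?orbT.
  by case=> Bx; rewrite inE => /orP[/eqP|]; [left|right].
by apply/seteqP; split=> x //= [[_ E] [_]]; rewrite E (negbTE us).
Qed.

Variable L : seq R.

(** Values outside the list [L] are merged. *)
Let trunc (y : {ffun V -> R}) : {ffun V -> 'I_(size L).+1} :=
  [ffun v => inord (index (y v) L)].
Definition trunc_pmf (u : {ffun V -> 'I_(size L).+1}) : R := mu [set y | trunc y = u].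
Definition trunc_val (v : V) (u : {ffun V -> 'I_(size L).+1}) : nat := u v.

Lemma trunc_pmfP : finite_pmf trunc_pmf.
Proof.
split=> [u|]; first exact: mu_ge0.
rewrite -muT; have := mu_sum trunc setT predT; rewrite setTI.
rewrite [X in mu X](_ : _ = setT); last by apply/seteqP.
by move=> <-; apply: eq_bigr => u _; rewrite setTI.
Qed.

Let trunc_mass (U : {set V}) u :
  mass trunc_pmf (same trunc_val U) u = mu [set y | same trunc_val U u (trunc y)].
Proof.
have := mu_sum trunc setT (same trunc_val U u); rewrite setTI => <-.
by apply: eq_bigr => w _; rewrite setTI.
Qed.

Let same_trunc (U : {set V}) (y z : {ffun V -> R}) :
  (forall v, v \in U -> y v = z v) -> same trunc_val U (trunc y) (trunc z).
Proof. by move=> yz; apply/sameP => v vU; rewrite /trunc_val !ffunE yz. Qed.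

Section Joint.
Variable U : {set V}.
Let JU := joint Y U.
Let restr (y : {ffun V -> R}) : {ffun {v | v \in U} -> R} := [ffun v => y (val v)].
Let JUE x : JU x = restr (J x). Proof. by apply/ffunP => v; rewrite !ffunE. Qed.
Let JU_pre B : JU @^-1` B = J @^-1` (restr @^-1` B).
Proof. by apply/seteqP; split=> x /=; rewrite JUE. Qed.
Let JU_countable : countable (range JU).
Proof.
have -> : range JU = restr @` range J.
  apply/seteqP; split=> [_ [x _ <-]|_ [_ [x _ <-] <-]].
    by rewrite JUE; exists (J x) => //; exists x.
  by exists x; rewrite ?JUE.
exact: card_le_trans (card_image_le _ _) J_countable.
Qed.

Let cls z := restr @^-1` [set z].
Let prob z : fine (P (JU @^-1` [set z])) = mu (cls z).
Proof. by rewrite JU_pre. Qed.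

(** Conditionally on a truncated value, the probability of each exact value [z]
    is at most that of its class, so that - ln of the former is larger; it
    remains to sum over the countably many [z]. *)
Lemma trunc_ent_le :
  ((ent trunc_pmf (same trunc_val U) / ln 2)%:E <= entropy P JU)%E.
Proof.
have l2 : 0 < ln 2 :> R := ln2_gt0.
pose m u := mass trunc_pmf (same trunc_val U) u.
have c0 u : 0 <= - ln (m u) / ln 2.
  by rewrite divr_ge0 ?(ltW l2) // oppr_ge0 ln_le0 // mass_le1 //; apply: trunc_pmfP.
have -> : ent trunc_pmf (same trunc_val U) / ln 2 =
    \sum_u (- ln (m u) / ln 2) * trunc_pmf u.
  rewrite /ent mulNr mulr_suml -sumrN; apply: eq_bigr => u _; rewrite /m; ring.
rewrite -sumEFin.
apply: (@le_trans _ _ (\sum_u \esum_(z in range JU)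
    ((- ln (m u) / ln 2)%:E * (mu ([set y | trunc y = u] `&` cls z))%:E))%E).
  apply: lee_sum => u _; rewrite EFinM.
  have -> : ((trunc_pmf u)%:E = \esum_(z in range JU) (mu ([set y | trunc y = u] `&` cls z))%:E)%E.
    rewrite /trunc_pmf -muE (@discrete_measure _ _ _ P _ JU) //.
      apply: eq_esum => z _; rewrite JU_pre -muE //.
    by move=> z; rewrite JU_pre.
  by apply: le_esum_scale => // z; rewrite lee_fin.
rewrite -esum_sum; last by move=> u z _ _; rewrite mule_ge0 // lee_fin.
apply: le_esum => z _; rewrite /= prob.
under eq_bigr do rewrite -EFinM.
rewrite sumEFin lee_fin.
have := mu_sum trunc (cls z) predT.
rewrite [X in _ = mu X](_ : _ = cls z); last by apply/seteqP; split=> y // [].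
move=> sumz; rewrite -{1}sumz mulr_suml -sumrN; apply: ler_sum => u _.
rewrite setIC; set q := mu (cls z `&` _).
have [q0|q0] := eqVneq q 0; first by rewrite q0 mulr0 mul0r oppr0.
have qpos : 0 < q by rewrite lt_neqAle eq_sym q0 mu_ge0.
have [y [yz yu]] : exists y, cls z y /\ trunc y = u.
  apply: boolp.contrapT => none; move: q0; rewrite /q /mu.
  rewrite (_ : cls z `&` _ = set0) ?preimage_set0 ?measure0 ?eqxx //.
  by apply/seteqP; split=> y // [yz yu]; apply: none; exists y.
have qz : q <= mu (cls z) by apply: muS => w [].
have zm : mu (cls z) <= m u.
  rewrite /m trunc_mass; apply: muS => w wz; rewrite /= -yu; apply: same_trunc => v vU.
  have : restr y = restr w by rewrite yz wz.
  by move/ffunP/(_ (exist _ v vU)); rewrite !ffunE.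
have z0 : 0 < mu (cls z) := lt_le_trans qpos qz.
have : ln (mu (cls z)) <= ln (m u).
  by rewrite ler_ln // posrE // (lt_le_trans z0).
move=> lnz.
have le_ln : - ln (m u) / ln 2 <= - (ln (mu (cls z)) / ln 2).
  by rewrite -mulNr ler_pM2r ?invr_gt0 // lerN2.
by rewrite -mulrN mulrC; apply: ler_wpM2l => //; apply: ltW.
Qed.

(** The values in [L] are not merged with others, so their terms occur unchanged
    in the entropy of the truncated variables. *)
Lemma trunc_ent_ge (s : seq {ffun {v | v \in U} -> R}) : uniq s ->
  (forall z v, z \in s -> z v \in L) ->
  \sum_(z <- s) (let p := fine (P (JU @^-1` [set z])) in - (p * (ln p / ln 2))) <=
  ent trunc_pmf (same trunc_val U) / ln 2.
Proof.
move=> us sL; have l2 : 0 < ln 2 :> R := ln2_gt0.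
pose m u := mass trunc_pmf (same trunc_val U) u.
pose C z : pred {ffun V -> 'I_(size L).+1} :=
  fun u => [forall v : {v | v \in U}, u (val v) == index (z v) L :> nat].
have trE y v : trunc y v = index (y v) L :> nat.
  by rewrite ffunE inordK // ltnS index_size.
have Ccls z : z \in s -> [set y | C z (trunc y)] = cls z.
  move=> zs; apply/seteqP; split=> y /=.
    move/forallP=> Cy; apply/ffunP => v; rewrite ffunE.
    have := eqP (Cy v); rewrite trE => /esym E.
    have := nth_index 0 (sL z v zs); rewrite E nth_index //.
    by rewrite -index_mem -E index_mem sL.
  by move=> <-; apply/forallP => v; rewrite trE ffunE.
have Csame z u w : C z u -> same trunc_val U u w = C z w.
  move=> /forallP zu; apply/sameP/forallP => [H v|H v vU].
    by rewrite -(eqP (zu v)); apply/eqP; have := H (val v) (valP v); rewrite /trunc_val => ->.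
  by have := eqP (zu (exist _ v vU)); have := eqP (H (exist _ v vU)); rewrite /trunc_val /= => -> ->.
have -> : ent trunc_pmf (same trunc_val U) / ln 2 =
    \sum_u trunc_pmf u * (- ln (m u) / ln 2).
  rewrite /ent mulNr mulr_suml -sumrN; apply: eq_bigr => u _; rewrite /m; ring.
have c0 u : 0 <= - ln (m u) / ln 2.
  by rewrite divr_ge0 ?(ltW l2) // oppr_ge0 ln_le0 // mass_le1 //; apply: trunc_pmfP.
apply: (@le_trans _ _ (\sum_(z <- s) \sum_(u | C z u) trunc_pmf u * (- ln (m u) / ln 2))).
  rewrite le_eqVlt; apply/orP; left; apply/eqP; apply: eq_big_seq => z zs /=.
  have sumz : \sum_(u | C z u) trunc_pmf u = mu (cls z).
    rewrite -Ccls //; have := mu_sum trunc setT (C z); rewrite setTI => <-.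
    by apply: eq_bigr => u _; rewrite setTI.
  rewrite prob (eq_bigr (fun u => trunc_pmf u * (- ln (mu (cls z)) / ln 2))); last first.
    move=> u zu; congr (_ * (- ln _ / _)); rewrite /m trunc_mass -(Ccls z zs).
    by congr mu; apply/seteqP; split=> y /=; rewrite (Csame z).
  by rewrite -mulr_suml sumz; ring.
under eq_bigr do rewrite big_mkcond.
rewrite exchange_big /=; apply: ler_sum => u _; rewrite -big_mkcond /=.
have [[z /andP[zs zu]]|none] := pselect (exists z, (z \in s) && C z u); last first.
  rewrite big1_seq; first by rewrite mulr_ge0 //; case: trunc_pmfP.
  by move=> z /andP[zu zs]; case: none; exists z; rewrite zs.
rewrite big_mkcond (bigD1_seq z) //= zu big1_seq ?addr0 // => w /andP[wz ws].
case: ifP => // wu; case/negP: wz; apply/eqP/ffunP => v.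
have := eqP (forallP wu v); rewrite (eqP (forallP zu v)) => E.
by rewrite -(nth_index 0 (sL w v ws)) -E nth_index // sL.
Qed.

End Joint.
End Truncation.

(** Truncation never increases entropies, and truncating outside a large enough
    finite set of values approaches the defining sums from below. *)
Lemma entropic_approx (R : realType) (V : finType) (h : {set V} -> R) :
  entropic h -> approximable finite_entropic h.
Proof.
case=> d [T [P [Y hE]]] e e0.
have ex (U : {set V}) : exists s : seq {ffun {v | v \in U} -> R}, uniq s /\
    h U - e < \sum_(z <- s) (let p := fine (P (joint Y U @^-1` [set z])) in - (p * (ln p / ln 2))).
  apply: boolp.contrapT => none.
  suff : (entropy P (joint Y U) <= (h U - e)%:E)%E by rewrite hE lee_fin; lra.
  apply: ge_ereal_sup => _ [F [finF _] <-].
  have /finite_seqP[s FE] := finF.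
  have us : uniq (undup s) := undup_uniq s.
  have -> : F = [set` undup s] by rewrite FE; apply/seteqP; split=> z /=; rewrite mem_undup.
  rewrite -fsbig_seq // sumEFin lee_fin leNgt; apply/negP => lt_s.
  by apply: none; exists (undup s).
have {}ex (U : {set V}) : exists LU : seq R, forall L, {subset LU <= L} ->
    h U - e < ent (trunc_pmf Y (L := L)) (same (@trunc_val R V L) U) / ln 2.
  have [s [us lt_s]] := ex U.
  pose vals (z : {ffun {v | v \in U} -> R}) := codom (fun v => z v).
  exists (flatten [seq vals z | z <- s]) => L sL; apply: lt_le_trans lt_s _.
  apply: trunc_ent_ge => // z v zs; apply: sL; apply/flattenP; exists (vals z).
    exact: (map_f vals).
  exact: (codom_f (fun v => z v)).
have [LU LUP] := boolp.choice ex.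
pose L := flatten [seq LU U | U <- enum {set V}].
exists (fun U => ent (trunc_pmf Y (L := L)) (same (@trunc_val R V L) U) / ln 2).
  exists {ffun V -> 'I_(size L).+1}, (trunc_pmf Y (L := L)), (@trunc_val R V L).
  by split=> //; apply: trunc_pmfP.
move=> U; have le1 : ent (trunc_pmf Y (L := L)) (same (@trunc_val R V L) U) / ln 2 <= h U.
  by rewrite -lee_fin -hE; apply: trunc_ent_le.
have : h U - e < ent (trunc_pmf Y (L := L)) (same (@trunc_val R V L) U) / ln 2.
  apply: LUP => x xU; apply/flattenP; exists (LU U) => //.
  by apply: map_f; rewrite mem_enum.
by rewrite ger0_norm; lra.
Qed.

(** * Finite probability spaces as measures on the natural numbers *)

Section NatVariable.
Context {R : realType} (f : nat -> R).

(** A name of its own for [f] lets it carry the structure of a discrete random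
    variable. *)
Definition nat_variable (i : nat) : R := f i.

Let nat_variable_measurable : measurable_fun [set: nat] nat_variable.
Proof. by []. Qed.

HB.instance Definition _ := isMeasurableFun.Build _ _ _ _ nat_variable
  nat_variable_measurable.

Let nat_variable_countable : countable (range nat_variable).
Proof. exact: card_le_trans (card_image_le _ _) (countableP _). Qed.

HB.instance Definition _ := MeasurableFun_isDiscrete.Build _ _ _ _ nat_variable
  nat_variable_countable.

End NatVariable.

Section NatMeasure.
Context {R : realType} {T : finType} (x0 : T) (p : T -> R) (p_pmf : finite_pmf p).

Let point (i : nat) : T := nth x0 (enum T) i.
Let weight (i : nat) : {nonneg R} := NngNum (proj1 p_pmf (point i)).

Definition nat_measure : set nat -> \bar R :=
  msum (fun i => mscale (weight i) (dirac i)) #|T|.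

HB.instance Definition _ := Measure.on nat_measure.

Lemma nat_measureE (A : set nat) :
  nat_measure A = (\sum_(x | (enum_rank x : nat) \in A) p x)%:E.
Proof.
rewrite /nat_measure /msum (reindex (@enum_rank T)) /=; last exact/onW_bij/enum_rank_bij.
rewrite -sumEFin [RHS]big_mkcond /=; apply: eq_bigr => x _.
transitivity ((p (point (enum_rank x)))%:E * \d_(enum_rank x : nat) A)%E => //.
rewrite diracE /point nth_enum_rank.
by case: ifP => _; rewrite ?mule1 ?mule0.
Qed.

Let nat_measure_setT : nat_measure setT = 1%E.
Proof.
rewrite nat_measureE (eq_bigl predT); first by rewrite (proj2 p_pmf).
by move=> x; rewrite in_setT.
Qed.

HB.instance Definition _ := Measure_isProbability.Build _ _ _ nat_measure nat_measure_setT.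

Definition nat_probability : probability nat R := nat_measure.

End NatMeasure.

Lemma finite_entropic_entropic (R : realType) (V : finType) (h : {set V} -> R) :
  finite_entropic h -> entropic h.
Proof.
case=> T [p [X [p_pmf hE]]].
have [x0 _] : exists x0 : T, True.
  apply: boolp.contrapT => none; have [_ /eqP] := p_pmf.
  by rewrite big1 ?(eq_sym 0) ?oner_eq0 // => x _; case: none; exists x.
pose point (i : nat) : T := nth x0 (enum T) i.
have pointK x : point (enum_rank x) = x by rewrite /point nth_enum_rank.
pose P := nat_probability x0 p_pmf.
pose Y (v : V) : {dRV P >-> R} := nat_variable (fun i => (X v (point i))%:R : R).
exists _, nat, P, Y => U; set JU := joint Y U.
pose Z (x : T) := JU (enum_rank x).
have ZE x y : (Z x == Z y) = same X U x y.
  apply/eqP/sameP => [/ffunP E v vU|E].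
    have := E (exist _ v vU); rewrite !ffunE /= /Y /nat_variable /= !pointK.
    by move/eqP; rewrite eqr_nat => /eqP.
  by apply/ffunP => -[v vU]; rewrite !ffunE /= /Y /nat_variable /= !pointK E.
have rangeE : range JU = [set` undup [seq Z x | x <- enum T]].
  apply/seteqP; split=> z /=; rewrite mem_undup.
    case=> i _ <-; apply/mapP; exists (point i); first by rewrite mem_enum.
    by apply/ffunP => v; rewrite !ffunE /= /Y /nat_variable /= pointK.
  by case/mapP=> x _ ->; exists (enum_rank x : nat).
have probE z : fine (P (JU @^-1` [set z])) = \sum_(x | Z x == z) p x.
  change (fine (nat_measure x0 p_pmf (JU @^-1` [set z])) = \sum_(x | Z x == z) p x).
  rewrite nat_measureE /=; apply: eq_bigl => x.
  by apply/idP/eqP; rewrite inE.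
rewrite /entropy rangeE esum_fset; last 2 first.
- by apply/finite_seqP; eexists.
- move=> z _; rewrite lee_fin probE -mulrN mulr_ge0 ?sumr_ge0 //; first by move=> x _; apply: (proj1 p_pmf).
  rewrite -mulNr divr_ge0 ?(ltW ln2_gt0) // oppr_ge0 ln_le0 //.
  by rewrite -(proj2 p_pmf) [leLHS]big_mkcond; apply: ler_sum => x _; case: ifP => // _; apply: (proj1 p_pmf).
rewrite -fsbig_seq ?undup_uniq // sumEFin hE; congr (_ %:E).
rewrite /ent mulNr mulr_suml -sumrN.
pose F x := p x * (ln (mass p (same X U) x) / ln 2).
transitivity (\sum_(z <- undup [seq Z x | x <- enum T]) \sum_(x | Z x == z) - F x).
  apply: eq_bigr => z _; rewrite /= probE sumrN mulr_suml; congr (- _).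
  apply: eq_bigr => x /eqP zx; rewrite /F /mass.
  congr (_ * (ln _ / _)); apply: eq_bigl => y.
  by rewrite -ZE zx eq_sym.
under eq_bigr do rewrite big_mkcond.
rewrite exchange_big /=; apply: eq_bigr => x _; rewrite -big_mkcond /=.
rewrite big_mkcond (bigD1_seq (Z x)) ?undup_uniq //=; last first.
  by rewrite mem_undup map_f // mem_enum.
rewrite eqxx big1 ?addr0; first by rewrite /F mulrA.
by move=> z; rewrite eq_sym => /negbTE->.
Qed.

Lemma almost_entropic_approx (R : realType) (V : finType) (h : {set V} -> R) :
  almost_entropic h <-> approximable finite_entropic h.
Proof.
split=> [/closure_approx hA|hA].
  move=> e e0; have e2 : 0 < e / 2 by lra.
  have [g /entropic_approx/(_ _ e2)[f fF gf] hg] := hA _ e2.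
  exists f => // U; have := hg U; have := gf U.
  have := ler_normD (h U - g U) (g U - f U); rewrite addrA subrK; lra.
apply/closure_approx => e /hA[g /finite_entropic_entropic gE hg].
by exists g.
Qed.

Close Scope classical_set_scope.

(** * Optimal set functions *)

Section Combinations.
Context {R : realType} {V : finType}.

Definition combo (l : seq (nat * ({set V} -> R))) (U : {set V}) : R :=
  \sum_(p <- l) p.1%:R * p.2 U.

Lemma combo_closed (C : ({set V} -> R) -> Prop) (l : seq (nat * ({set V} -> R))) :
  C (fun=> 0) -> (forall g1 g2, C g1 -> C g2 -> C (fun U => g1 U + g2 U)) ->
  List.Forall (fun p => C p.2) l -> C (combo l).
Proof.
move=> C0 CD; elim=> [|[n g] {}l Cg _ IHl].
  have -> // : combo [::] = fun=> 0.
  by apply: boolp.funext => U; rewrite /combo big_nil.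
have -> : combo ((n, g) :: l) = fun U => n%:R * g U + combo l U.
  by apply: boolp.funext => U; rewrite /combo big_cons.
rewrite /= in Cg; apply: (CD _ _ _ IHl); elim: n => [|n IHn].
  have -> // : (fun U => 0%:R * g U) = fun=> 0.
  by apply: boolp.funext => U; rewrite mul0r.
have -> : (fun U => n.+1%:R * g U) = fun U => n%:R * g U + g U.
  by apply: boolp.funext => U; rewrite -addn1 natrD mulrDl mul1r.
exact: CD.
Qed.

End Combinations.

Section Optimal.
Context {R : realType}.
Implicit Types F : bool -> bool -> bool -> bool -> bool -> R.

Definition padded F (U : {set G32}) : R := core_fun F U + padding U.

Lemma padded_core F U : core_fun F U = padded F (U :&: vset (iota 0 5))%SET.
Proof.
rewrite /padded /padding big1 ?addr0.
  by rewrite /core_fun !finset.in_setI !in_vsetE //= !andbT.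
move=> x; rewrite finset.in_setI in_vset mem_iota => /andP[_ /andP[_ x5]].
by rewrite /weight12 x5 mul0r.
Qed.

(** The caps on single core vertices are what the link vertices next to them
    allow; the other conditions are the linear program for the core. *)
Lemma padded_optimal F s :
  polymatroid (padded F) -> F false false false false false = 0 ->
  [/\ F true false false false false <= 2 / 3, F false true false false false <= 2 / 3,
      F false false true false false <= 2 / 3, F false false false true false <= 2 / 3
    & F false false false false true <= 3 / 4] ->
  [/\ F true true false false false <= 1, F true false true false false <= 1 &
    [/\ F true false false true false <= 1, F false true true false false <= 1,
      F false true false true false <= 1, F false false true false true <= 1
    & F false false false true true <= 1]] ->
  [/\ s <= F true false false false true, s <= F false true false false true,
      s <= F false false true true false, s <= F true true true false false
    & s <= F true true false true false] ->
  edge_dominated (padded F) /\ s + 5 <= width (padded F).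
Proof.
move=> [h0 _ hmono _] F0 [c0 c1 c2 c3 c4] [e0 e1 [e2 e3 e4 e5 e6]] [k0 k1 k2 k3 k4].
split.
  apply: edge_dominatedP => //.
  - by move=> U; rewrite padded_core.
  - rewrite /core_fun; case=> [|[|[|[|[|//]]]]] _; rewrite !in_vsetE //= ?inE /=; lra.
  - move=> i j; rewrite !inE /core_fun => /or4P[|||/or4P[|||]] /eqP[-> ->];
      by rewrite !in_vsetE.
apply: width_ge.
  move=> U W UW; rewrite !padded_core.
  have /finset.setUidPr <- : U :&: vset (iota 0 5) \subset W :&: vset (iota 0 5).
    exact: finset.setSI.
  exact: hmono.
by case=> [|[|[|[|[|//]]]]] _; rewrite /core_fun !in_vsetE.
Qed.

Lemma step_vsetU s U : all (fun i => i < 32)%N s ->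
  step (vset s) U = (has (fun i => vtx i \in U) s)%:R :> R.
Proof.
move=> s32; rewrite -(step_vset U s32) !stepE.
by rewrite finset.setIC.
Qed.

Definition pads (m : nat) : seq (nat * ({set G32} -> R)) :=
  [seq ((m * weight12 (idx x))%N, step [set x]%SET : _ -> R) | x <- enum G32].

Lemma combo_pads m U : combo (pads m) U = (m * 12)%:R * padding U.
Proof.
rewrite /combo /pads big_map /= modular_steps /padding big_distrr /=.
by apply: eq_bigr => x _; rewrite !natrM; field.
Qed.

Lemma forall_pads (C : ({set G32} -> R) -> Prop) m :
  (forall K, C (step K)) -> List.Forall (fun p => C p.2) (pads m).
Proof.
by move=> Cs; rewrite /pads; elim: (enum _) => [|x s IHs] /=; constructor; first exact: Cs.
Qed.

Lemma combo_cat (V : finType) (l1 l2 : seq (nat * ({set V} -> R))) U :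
  combo (l1 ++ l2) U = combo l1 U + combo l2 U.
Proof. by rewrite /combo big_cat. Qed.

Lemma le_sup_width (C : set ({set G32} -> R)) h (t : R) :
  C h -> edge_dominated h -> t <= width h -> (t%:E <= sup_width C)%E.
Proof.
move=> Ch hE th; apply: le_trans (_ : (width h)%:E <= _)%E; first by rewrite lee_fin.
by apply: ereal_sup_ubound; exists h.
Qed.

Lemma sup_width_le (C : set ({set G32} -> R)) (s : R) : 1 <= s ->
  (forall h, C h -> polymatroid h) ->
  (forall h, C h -> edge_dominated h -> exists2 k, (k < 5)%N & h (vset (key k)) <= s) ->
  (sup_width C <= (s + 5)%:E)%E.
Proof.
move=> s1 CP Ck; apply: ge_ereal_sup => _ [h [Ch hE] <-].
by rewrite lee_fin width_le //; [apply: CP | apply: Ck].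
Qed.

Lemma sup_width_eq (C : set ({set G32} -> R)) (s t : R) : (t%:E <= sup_width C)%E ->
  (sup_width C <= (s + 5)%:E)%E -> t = s + 5 -> sup_width C = t%:E.
Proof. by move=> ge le ts; apply/eqP; rewrite eq_le ge ts le. Qed.

(* Closed sums and minima of natural numbers are computed before [lra] sees
   them. *)
Ltac eval_nat := rewrite /=; repeat match goal with
  | |- context [GRing.natmul 1 ?n] => let m := eval vm_compute in n in
      tryif constr_eq n m then fail else change n with m end.

(** ** Adaptive width *)

Definition modular_core (a b c d e : bool) : R := (a + b + c + d + e)%:R / 2.

Lemma modular_padded : modular (padded modular_core).
Proof.
pose w (x : G32) : R := if (idx x < 5)%N then 1 / 2 else (weight12 (idx x))%:R / 12.
exists w; split=> [x|U]; first by rewrite /w; case: ifP => _; rewrite divr_ge0.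
have -> : \sum_(x in U) w x =
    \sum_(x in U) (if (idx x < 5)%N then 1 / 2 else 0) + padding U.
  rewrite -big_split /=; apply: eq_bigr => x _; rewrite /w /weight12.
  by case: (idx x < 5)%N; rewrite ?mulr0n ?mul0r ?addr0 ?add0r.
congr (_ + _).
transitivity (\sum_(x in vset (iota 0 5)) (vtx (idx x) \in U)%:R / 2 : R).
  rewrite (sum_vset (fun i => (vtx i \in U)%:R / 2)) // !big_cons big_nil.
  by rewrite /core_fun /modular_core !natrD; lra.
have x5 x : (x \in vset (iota 0 5)) = (idx x < 5)%N by rewrite in_vset mem_iota.
rewrite [LHS]big_mkcond [RHS]big_mkcond; apply: eq_bigr => x _.
rewrite x5 idxK.
by case: (x \in U); case: (idx x < 5)%N => //; rewrite mul0r.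
Qed.

Lemma adw_G32 : adw R G32 = 6%:E.
Proof.
apply: (@sup_width_eq _ 1); last by lra.
- have M := modular_padded.
  have [||||hE hw] := @padded_optimal modular_core 1 (normal_polymatroid (modular_normal M)).
  + by rewrite /modular_core; eval_nat; lra.
  + by rewrite /modular_core; eval_nat; split; lra.
  + by rewrite /modular_core; eval_nat; split; [| |split]; lra.
  + by rewrite /modular_core; eval_nat; split; lra.
  apply: le_sup_width M hE _; lra.
- apply: sup_width_le => //; first by move=> h /modular_normal/normal_polymatroid.
  exact: adw_key.
Qed.

(** ** Normal width *)

(** The coefficients solve the linear program whose dual solution is the
    combination in the proof of [normw_key]. *)
Definition normal_core (a b c d e : bool) : R :=
  (2 * a + 2 * b + (a || c) + (a || d) + (b || c) + (b || d) + 4 * (c || e) + 4 * (d || e)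
   + (a || b || c) + (a || b || d))%:R / 11.

Definition vstep (s : seq nat) : {set G32} -> R := step (vset s).

Lemma normal_padded : normal (padded normal_core).
Proof.
pose l := [:: (24, vstep [:: 0]); (24, vstep [:: 1]); (12, vstep [:: 0; 2]);
  (12, vstep [:: 0; 3]); (12, vstep [:: 1; 2]); (12, vstep [:: 1; 3]);
  (48, vstep [:: 2; 4]); (48, vstep [:: 3; 4]);
  (12, vstep [:: 0; 1; 2]); (12, vstep [:: 0; 1; 3])]%N ++ pads 11.
have lN : normal (combo l).
  apply: combo_closed.
  - by exists (fun=> 0); split=> // U; rewrite big1 // => K _; rewrite mul0r.
  - move=> g1 g2 [c1 [c10 E1]] [c2 [c20 E2]]; exists (fun K => c1 K + c2 K).
    split=> [K|U]; first by rewrite addr_ge0.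
    by rewrite E1 E2 -big_split; apply: eq_bigr => K _; rewrite mulrDl.
  - rewrite /l; repeat (constructor; first exact: normal_step).
    exact: forall_pads normal_step.
have -> : padded normal_core = fun U => \sum_(i <- [:: tt]) (1 / 132) * combo l U.
  apply: boolp.funext => U; rewrite big_seq1 combo_cat combo_pads.
  rewrite /combo !big_cons big_nil /vstep /= !step_vsetU //= /padded /core_fun /normal_core.
  by rewrite !orbF !orbA !natrD !natrM; lra.
by apply: normal_sum.
Qed.

Lemma normw_G32 : normw R G32 = (69 / 11)%:E.
Proof.
apply: (@sup_width_eq _ (14 / 11)); last by lra.
- have M := normal_padded.
  have [||||hE hw] := @padded_optimal normal_core (14 / 11) (normal_polymatroid M).
  + by rewrite /normal_core; eval_nat; lra.
  + by rewrite /normal_core; eval_nat; split; lra.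
  + by rewrite /normal_core; eval_nat; split; [| |split]; lra.
  + by rewrite /normal_core; eval_nat; split; lra.
  apply: le_sup_width M hE _; lra.
- apply: sup_width_le; [by lra | by move=> h /normal_polymatroid | exact: normw_key].
Qed.

(** ** Linear width *)

Definition xor_value (a b e k : bool) : nat := if k then 2 else minn 2 (a + b + e).

(** All inequalities in the proof of [linw_key] are equalities for this
    function; beyond the normal case, it uses two bits with their sum. *)
Definition linear_core (a b c d e : bool) : R :=
  (3 * a + 3 * b + 2 * c + (a || d) + (b || d) + 4 * (c || e) + 6 * (d || e)
   + (a || b || c) + 2 * (a || b || d) + 3 * xor_value a b e c
   + 2 * xor_value a b e d)%:R / 21.

Definition vxor (k : nat) (U : {set G32}) : R := (xor_rank k U)%:R.

Lemma linear_padded : linear_polymatroid (padded linear_core).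
Proof.
pose l := [:: (12, vstep [:: 0]); (12, vstep [:: 1]); (8, vstep [:: 2]);
  (4, vstep [:: 0; 3]); (4, vstep [:: 1; 3]); (16, vstep [:: 2; 4]); (24, vstep [:: 3; 4]);
  (4, vstep [:: 0; 1; 2]); (8, vstep [:: 0; 1; 3]); (12, vxor 2); (8, vxor 3)]%N ++ pads 7.
have lN : rank_function (combo l).
  apply: combo_closed; [exact: rank_function0 | exact: rank_functionD |].
  rewrite /l; repeat (constructor; first exact: rank_function_step).
  do 2! (constructor; first exact: xor_rank_function).
  exact: forall_pads rank_function_step.
have -> : padded linear_core = fun U => (1 / 84) * combo l U.
  apply: boolp.funext => U; rewrite combo_cat combo_pads.
  rewrite /combo !big_cons big_nil /vstep /vxor /= !step_vsetU //= /padded /core_fun.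
  by rewrite /linear_core !orbF !orbA !natrD !natrM /xor_rank /xor_value; lra.
by apply: scaled_rank_linear => //; lra.
Qed.

Lemma linw_G32 : linw R G32 = (44 / 7)%:E.
Proof.
apply: (@sup_width_eq _ (9 / 7)); last by lra.
- have M := linear_padded.
  have [||||hE hw] := @padded_optimal linear_core (9 / 7) (linear_is_polymatroid M).
  + by rewrite /linear_core; eval_nat; lra.
  + by rewrite /linear_core; eval_nat; split; lra.
  + by rewrite /linear_core; eval_nat; split; [| |split]; lra.
  + by rewrite /linear_core; eval_nat; split; lra.
  apply: le_sup_width M hE _; lra.
- apply: sup_width_le; [by lra | by move=> h /linear_is_polymatroid |].
  by move=> h hL hE; apply: linw_key (linear_is_polymatroid hL) hE (linear_ingleton hL).
Qed.

(** ** Entropic width *)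

Lemma almost_entropic_polymatroid (h : {set G32} -> R) : almost_entropic h -> polymatroid h.
Proof.
by move=> /almost_entropic_approx/polymatroid_approx; apply; apply: finite_entropic_polymatroid.
Qed.

Lemma almost_entropic_zhang_yeung (h : {set G32} -> R) p q :
  almost_entropic h -> zhang_yeung h p q.
Proof.
move=> /almost_entropic_approx hA.
pose l : seq (R * {set G32}) := [:: (-2, vset [:: 0%N]); (-2, vset [:: 1%N]);
  (-1, vset [:: p]); (-1, vset [:: p; q]); (-4, vset [:: 0%N; 1%N; p]);
  (-1, vset [:: 0%N; 1%N; q]); (3, vset [:: 0; 1]%N); (3, vset [:: 0%N; p]);
  (3, vset [:: 1%N; p]); (1, vset [:: 0%N; q]); (1, vset [:: 1%N; q])].
have : 0 <= lform l h.
  apply: approx_lform_ge0 hA _ => g /(finite_entropic_zhang_yeung p q).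
  by rewrite /zhang_yeung /lform !big_cons big_nil /=; lra.
by rewrite /zhang_yeung /lform !big_cons big_nil /=; lra.
Qed.

(** The conjunction and disjunction of two bits violate the Ingleton inequality
    slightly and have the entropies of edges of equal value; the other terms
    raise all keys to the same level. *)
Definition entropic_core (a b c d e : bool) : R :=
  (12 * a + 12 * b + 24 * (c || e) + 24 * (d || e) + 7 * (a || b || c) + 7 * (a || b || d)
   + 12 * xor_value a b e c + 12 * xor_value a b e d)%:R / 101
  + 10 / 101 * andor_value a b c d.

Lemma entropic_padded : almost_entropic (padded entropic_core).
Proof.
pose l := [:: (144, vstep [:: 0]); (144, vstep [:: 1]); (288, vstep [:: 2; 4]);
  (288, vstep [:: 3; 4]); (84, vstep [:: 0; 1; 2]); (84, vstep [:: 0; 1; 3]);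
  (144, vxor 2); (144, vxor 3); (120, andor)]%N ++ pads 101.
have lF : finite_entropic (combo l).
  apply: combo_closed; [exact: finite_entropic0 | exact: finite_entropicD |].
  rewrite /l; repeat (constructor; first exact: finite_entropic_step).
  do 2! (constructor; first exact: finite_entropic_xor).
  constructor; first exact: finite_entropic_andor.
  exact: forall_pads (@finite_entropic_step _ _).
apply/almost_entropic_approx.
have -> : padded entropic_core = fun U => combo l U / 1212%:R.
  apply: boolp.funext => U; rewrite combo_cat combo_pads.
  rewrite /combo !big_cons big_nil /vstep /vxor /= !step_vsetU //= /padded /core_fun.
  by rewrite /entropic_core /andor !orbF !orbA !natrD !natrM /xor_rank /xor_value; lra.
exact: finite_entropic_scale.
Qed.

Lemma entw_G32_ge : ((635 / 101)%:E <= entw R G32)%E.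
Proof.
have M := entropic_padded.
have /andP[lo hi] := @andor_conj R.
have [||||hE hw] := @padded_optimal entropic_core (130 / 101) (almost_entropic_polymatroid M).
- by rewrite /entropic_core /andor_value; eval_nat; lra.
- by rewrite /entropic_core /andor_value; eval_nat; split; lra.
- by rewrite /entropic_core /andor_value; eval_nat; split; [| |split]; lra.
- by rewrite /entropic_core /andor_value; eval_nat; split; lra.
apply: le_sup_width M hE _; lra.
Qed.

Lemma entw_G32_le : (entw R G32 <= (183 / 29)%:E)%E.
Proof.
rewrite (_ : 183 / 29 = 38 / 29 + 5); last by lra.
apply: sup_width_le; [by lra | exact: almost_entropic_polymatroid |].
move=> h hA hE; apply: entw_key (almost_entropic_polymatroid hA) hE _ _;
  exact: almost_entropic_zhang_yeung.
Qed.

(** ** Submodular width *)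

Definition lines_core (a b c d e : bool) : R := (lines_rank a b c d e)%:R / 3.

Lemma lines_padded : polymatroid (padded lines_core).
Proof.
have pad : polymatroid (fun U => \sum_(x <- enum G32) (weight12 (idx x))%:R / 12 * step [set x]%SET U : R).
  by apply: polymatroid_sum => x; [rewrite divr_ge0 | apply: polymatroid_step].
have := @polymatroid_sum R G32 bool [:: true; false] (fun=> 1)
  (fun b => if b then core_fun lines_core else fun U => \sum_(x <- enum G32)
     (weight12 (idx x))%:R / 12 * step [set x]%SET U).
rewrite [X in _ -> _ -> polymatroid X](_ : _ = padded lines_core); last first.
  by apply: boolp.funext => U; rewrite !big_cons big_nil modular_steps !mul1r addr0.
by apply=> // -[//|//]; apply: lines_rank_polymatroid.
Qed.

Lemma subw_G32 : subw R G32 = (19 / 3)%:E.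
Proof.
apply: (@sup_width_eq _ (4 / 3)); last by lra.
- have M := lines_padded.
  have [||||hE hw] := @padded_optimal lines_core (4 / 3) M.
  + by rewrite /lines_core; eval_nat; lra.
  + by rewrite /lines_core; eval_nat; split; lra.
  + by rewrite /lines_core; eval_nat; split; [| |split]; lra.
  + by rewrite /lines_core; eval_nat; split; lra.
  apply: le_sup_width M hE _; lra.
- apply: sup_width_le; [by lra | by [] | exact: subw_key].
Qed.

End Optimal.

Theorem theorem1 (R : realType) :
  exists G : sgraph,
    [/\ #|G| = 32%N, no_isolated G &
      [/\ adw R G = 6%:E /\ (6%:E < normw R G)%E,
          normw R G = (69 / 11)%:E /\ (normw R G < linw R G)%E,
          linw R G = (44 / 7)%:E /\ (linw R G < (635 / 101)%:E)%E,
          ((635 / 101)%:E <= entw R G)%E /\ (entw R G <= (183 / 29)%:E)%E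
        & ((183 / 29)%:E < subw R G)%E /\ subw R G = (19 / 3)%:E]].
Proof.
exists G32; split; [exact: card_ord | exact: G32_no_isolated |].
rewrite adw_G32 normw_G32 linw_G32 subw_G32 !lte_fin.
by split; split=> //; first [exact: entw_G32_ge | exact: entw_G32_le | lra].
Qed.
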